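(* For single patterns in $S_3$ the following hold: (i) $[132]_{\mathrm{fp},\mathrm{exc},\mathrm{inv},\mathrm{crs},\mathrm{nes}}=\{132,213\}$; (ii) $[231]_{\mathrm{fp},\mathrm{inv},\mathrm{nes}}=\{231,312\}$; (iii) $[132]_{\mathrm{fp},\mathrm{exc},\mathrm{crs}}=\{132,213,321\}$.
   Context: $S_n(\tau)$: permutations of $[n]$ avoiding the pattern $\tau$. For $\sigma\in S_n$: $\mathrm{fp}(\sigma)=|\{i:\sigma(i)=i\}|$; $\mathrm{exc}(\sigma)=|\{i:\sigma(i)>i\}|$; $\mathrm{inv}(\sigma)=|\{(i,j):i<j,\ \sigma(i)>\sigma(j)\}|$; a crossing is a pair $(i,j)$ with $i<j<\sigma(i)<\sigma(j)$ or $\sigma(i)<\sigma(j)\le i<j$, a nesting a pair with $i<j<\sigma(j)<\sigma(i)$ or $\sigma(j)<\sigma(i)\le i<j$, and $\mathrm{crs},\mathrm{nes}$ count them. Patterns $\tau,\tau'$ are $(\mathrm{st}_1,\dots,\mathrm{st}_k)$-Wilf-equivalent if for every $n$, $\sum_{\sigma\in S_n(\tau)}\prod_i x_i^{\mathrm{st}_i(\sigma)}=\sum_{\sigma\in S_n(\tau')}\prod_i x_i^{\mathrm{st}_i(\sigma)}$. $[\tau]_{\mathrm{st}_1,\dots,\mathrm{st}_k}$ denotes the set of $\tau'\in S_3$ that are $(\mathrm{st}_1,\dots,\mathrm{st}_k)$-Wilf-equivalent to $\tau$. *)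

(* Defs.v *)
From mathcomp Require Import all_boot all_order all_fingroup all_algebra.
From mathcomp Require Import mpoly.

Set Implicit Arguments.
Unset Strict Implicit.
Unset Printing Implicit Defensive.

Import GRing.Theory.

(* Permutations of [n] = {1, .., n} are elements of 'S_n, i.e. permutations of
   {0, .., n-1}. Both positions and values are shifted by one, so the
   comparisons between positions and values below are unaffected. *)

Lemma one_line_inj (n : nat) (w : seq nat) :
  perm_eq w (iota 1 n.+1) ->
  injective (fun i : 'I_n.+1 => inord (nth 0 w i).-1 : 'I_n.+1).
Proof.
move=> hw i j.
have sz : size w = n.+1 by rewrite (perm_size hw) size_iota.
have bnd (k : 'I_n.+1) : 0 < nth 0 w k <= n.+1.
  have: nth 0 w k \in w by rewrite mem_nth // sz.
  by rewrite (perm_mem hw) mem_iota add1n ltnS.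
have /andP[i0 in1] := bnd i; have /andP[j0 jn1] := bnd j.
move/(congr1 (@nat_of_ord _)); rewrite !inordK ?prednK // => eqij.
apply/val_inj/eqP; rewrite /= -(nth_uniq 0 _ _ (_ : uniq w)) ?sz //.
  by rewrite -(prednK i0) -(prednK j0) eqij.
by rewrite (perm_uniq hw) iota_uniq.
Qed.

(* The permutation whose (1-based) one-line notation is w. *)
Definition one_line (n : nat) (w : seq nat)
  (hw : perm_eq w (iota 1 n.+1)) : 'S_n.+1 := perm (one_line_inj hw).

Lemma one_lineE (n : nat) (w : seq nat) (hw : perm_eq w (iota 1 n.+1))
  (i : 'I_n.+1) : (one_line hw i).+1 = nth 0 w i.
Proof.
have: nth 0 w i \in w.
  by rewrite mem_nth // (perm_size hw) size_iota.
rewrite (perm_mem hw) mem_iota add1n ltnS => /andP[w0 wn].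
by rewrite permE inordK ?prednK.
Qed.

Definition p132 : 'S_3 := @one_line 2 [:: 1; 3; 2] isT.
Definition p213 : 'S_3 := @one_line 2 [:: 2; 1; 3] isT.
Definition p231 : 'S_3 := @one_line 2 [:: 2; 3; 1] isT.
Definition p312 : 'S_3 := @one_line 2 [:: 3; 1; 2] isT.
Definition p321 : 'S_3 := @one_line 2 [:: 3; 2; 1] isT.

Definition contains (k n : nat) (tau : 'S_k) (sigma : 'S_n) : bool :=
  [exists f : {ffun 'I_k -> 'I_n},
     [forall a : 'I_k, forall b : 'I_k, (a < b) ==> (f a < f b)] &&
     [forall a : 'I_k, forall b : 'I_k,
        (sigma (f a) < sigma (f b)) == (tau a < tau b)]].

Definition avoiders (k : nat) (tau : 'S_k) (n : nat) : {set 'S_n} :=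
  [set sigma | ~~ contains tau sigma].

Definition perm_stat : Type := forall n : nat, 'S_n -> nat.

Definition st_fp : perm_stat := fun n s => #|[set i : 'I_n | s i == i]|.

Definition st_exc : perm_stat := fun n s => #|[set i : 'I_n | i < s i]|.

Definition st_inv : perm_stat := fun n s =>
  #|[set ij : 'I_n * 'I_n | (ij.1 < ij.2) && (s ij.2 < s ij.1)]|.

Definition crossing (n : nat) (s : 'S_n) (i j : 'I_n) : bool :=
  [&& i < j, j < s i & s i < s j] || [&& s i < s j, s j <= i & i < j].

Definition nesting (n : nat) (s : 'S_n) (i j : 'I_n) : bool :=
  [&& i < j, j < s j & s j < s i] || [&& s j < s i, s i <= i & i < j].

Definition st_crs : perm_stat := fun n s =>
  #|[set ij : 'I_n * 'I_n | crossing s ij.1 ij.2]|.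

Definition st_nes : perm_stat := fun n s =>
  #|[set ij : 'I_n * 'I_n | nesting s ij.1 ij.2]|.

Definition gen_poly (m : nat) (st : m.-tuple perm_stat) (k : nat) (tau : 'S_k)
  (n : nat) : {mpoly int[m]} :=
  (\sum_(sigma in avoiders tau n)
      \prod_(i < m) 'X_i ^+ (tnth st i n sigma))%R.

Definition wilf_equiv (m : nat) (st : m.-tuple perm_stat) (k k' : nat)
  (tau : 'S_k) (tau' : 'S_k') : Prop :=
  forall n : nat, gen_poly st tau n = gen_poly st tau' n.

(* [tau]_{st}, as a predicate on S_3: Wilf-equivalence quantifies over all n,
   so it is not a boolean predicate and does not form a {set 'S_3}. *)
Definition wilf_class (m : nat) (st : m.-tuple perm_stat) (tau : 'S_3) :
  'S_3 -> Prop := fun tau' => wilf_equiv st tau tau'.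

(* Main.v *)
Require Import Defs.
From mathcomp Require Import all_boot all_fingroup.
From mathcomp Require Import all_algebra.
From mathcomp Require Import mpoly zify ring.

Set Implicit Arguments.
Unset Strict Implicit.
Unset Printing Implicit Defensive.

Import GRing.Theory.

(** Inequivalences are already visible at n = 3, where avoiding tau means being
    different from tau.  The symmetry s |-> rev s^-1 rev preserves all five
    statistics and exchanges 132 and 213; inversion preserves fp, inv and nes
    and exchanges 231 and 312.

    The equivalence of 132 and 321 for (fp, exc, crs) holds because both
    generating functions count the same weighted Motzkin paths.  A permutation
    avoiding 321 is determined by its excedance positions and excedance values,
    hence by a bicoloured Motzkin path whose heights h_p give
    crs = sum_p (h_p - [p is an excedance value]).  A permutation avoiding 132,
    of the form L n R with L > R, corresponds to the Dyck path U L D R.  The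
    entry s(j) then becomes a pair of matched steps whose centre is at distance
    s(j) - j from the middle line, and crs and exc are determined by how the
    pairs of matched steps meet that line.  Reading the Dyck path outwards from
    its middle, two steps at a time, gives a walk on the states (a, b) of the
    unmatched down and up steps.  The weighted number of walks reaching (a, b)
    depends only on h = (a + b) / 2, and as a function of h it satisfies the
    recursion of the Motzkin paths above. *)

(** * Finite sums and sequences *)

Lemma card_set_sum (T : finType) (P : pred T) : #|[set x | P x]| = \sum_x P x.
Proof. by rewrite -sum1dep_card big_mkcond; apply: eq_bigr => x _; case: (P x). Qed.

Lemma card_pair_sum (T : finType) (P : rel T) :
  #|[set xy : T * T | P xy.1 xy.2]| = \sum_x \sum_y P x y.
Proof. by rewrite card_set_sum pair_bigA. Qed.

Lemma card_pair_reindex (T : finType) (g : T -> T) (P Q : rel T) :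
  injective g -> (forall x y, P (g x) (g y) = Q x y) ->
  #|[set xy : T * T | P xy.1 xy.2]| = #|[set xy : T * T | Q xy.1 xy.2]|.
Proof.
move=> g_inj PQ; pose gg (xy : T * T) := (g xy.1, g xy.2).
have gg_inj : injective gg by move=> [x y] [x' y'] [/g_inj-> /g_inj->].
by rewrite -(card_preimset _ gg_inj); apply: eq_card => xy; rewrite !inE PQ.
Qed.

Lemma card_pair_swap (T : finType) (P : rel T) :
  #|[set xy : T * T | P xy.2 xy.1]| = #|[set xy : T * T | P xy.1 xy.2]|.
Proof. by rewrite (card_pair_sum (fun x y => P y x)) exchange_big card_pair_sum. Qed.

Lemma big_tuple_cons (V : nmodType) (T : finType) (n : nat) (F : seq T -> V) :
  (\sum_(w : n.+1.-tuple T) F w = \sum_(c : T) \sum_(w : n.-tuple T) F (c :: w))%R.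
Proof.
pose split (w : n.+1.-tuple T) := (thead w, [tuple of behead w]).
pose join (cw : T * n.-tuple T) := [tuple of cw.1 :: cw.2].
rewrite pair_bigA (reindex_onto join split) => [|w _]; last by rewrite [RHS]tuple_eta.
apply: eq_bigl => -[c w]; rewrite /split theadE; apply/eqP; congr pair.
exact/val_inj.
Qed.

Lemma big_tuple_rcons (V : nmodType) (T : finType) (n : nat) (F : seq T -> V) :
  (\sum_(w : n.+1.-tuple T) F w = \sum_(w : n.-tuple T) \sum_(c : T) F (rcons w c))%R.
Proof.
have rev_inj m : injective (fun w : m.-tuple T => [tuple of rev w]).
  by move=> v w /(congr1 val)/(inv_inj revK)/val_inj.
rewrite (reindex_inj (@rev_inj n.+1)) (big_tuple_cons _ (fun w => F (rev w))).
rewrite exchange_big (reindex_inj (@rev_inj n)); apply: eq_bigr => w _.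
by apply: eq_bigr => c _; rewrite /= rev_cons revK.
Qed.

Lemma big_bool_pair (V : nmodType) (F : bool * bool -> V) :
  (\sum_c F c =
   F (true, true) + F (true, false) + F (false, true) + F (false, false))%R.
Proof.
transitivity (\sum_c F (c.1, c.2))%R; first by apply: eq_bigr => -[].
by rewrite -(pair_bigA _ (fun a b => F (a, b))) !big_bool /= !addrA.
Qed.

Lemma sum_ord_eq (n c : nat) (b : bool) :
  \sum_(p < n) ((p == c :> nat) && b) = (c < n) && b.
Proof.
elim: n => [|n IH]; first by rewrite big_ord0.
by rewrite big_ord_recr /= IH; lia.
Qed.

Lemma sum_interval (n a b : nat) : \sum_(p < n) (a <= p < b) = minn b n - minn a n.
Proof.
elim: n => [|n IH]; first by rewrite big_ord0; lia.
by rewrite big_ord_recr /= IH; lia.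
Qed.

Lemma sum_iota_geq (a v k : nat) : \sum_(y <- iota v k) (a <= y) = minn k (v + k - a).
Proof.
elim: k => [|k IH]; first by rewrite big_nil; lia.
by rewrite -addn1 iotaD big_cat big_seq1 /= IH; lia.
Qed.

Lemma count_take_sum (T : Type) (x0 : T) (a : pred T) (w : seq T) (p : nat) :
  count a (take p w) = \sum_(i < size w) (a (nth x0 w i) && (i < p)).
Proof.
elim: w p => [|c w IH] [|p] /=; rewrite ?big_ord0 //.
  by rewrite big1 // => i _; rewrite andbF.
by rewrite big_ord_recl IH /= andbT; congr (_ + _); apply: eq_bigr.
Qed.

Lemma leq_count_take (T : eqType) (a : pred T) (w : seq T) (i j : nat) :
  i <= j -> count a (take i w) <= count a (take j w).
Proof.
by move=> ij; rewrite -(take_takel w ij); apply/leq_count_subseq/take_subseq.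
Qed.

Lemma ltn_count_take (T : eqType) (x0 : T) (a : pred T) (w : seq T) (i j : nat) :
  i < j -> i < size w -> a (nth x0 w i) -> count a (take i w) < count a (take j w).
Proof.
move=> ij iw ai; apply: leq_trans (leq_count_take a w ij).
by rewrite (take_nth x0 iw) -cats1 count_cat /= ai addn1.
Qed.

Lemma perm_eq_bool (s t : seq bool) :
  size s = size t -> count id s = count id t -> perm_eq s t.
Proof.
have countE (a : pred bool) (r : seq bool) :
    count a r + a false * count id r = a true * count id r + a false * size r.
  elim: r => [|[] r IH] /=; rewrite ?muln0 //; move: IH;
  by case: (a true); case: (a false); lia.
move=> sz ct; apply/seq.permP => a; have := countE a s; rewrite sz ct -countE.
exact: addIn.
Qed.

Lemma iota_cat_cons (w1 w2 : seq nat) (x u m : nat) :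
  w1 ++ x :: w2 = iota u m ->
  [/\ w1 = iota u (size w1), x = u + size w1 & w2 = iota (u + size w1).+1 (size w2)].
Proof.
move=> e; have em : m = size w1 + (size w2).+1.
  by rewrite -(size_iota u m) -e size_cat.
move/eqP: e; rewrite em iotaD eqseq_cat ?size_iota //= eqseq_cons.
by case/and3P=> /eqP-> /eqP-> /eqP->; rewrite !size_iota.
Qed.

Lemma perm_iota_split (w1 w2 : seq nat) (v m : nat) :
  perm_eq (w1 ++ w2) (iota v m) -> {in w1 & w2, forall x y, y <= x} ->
  perm_eq w1 (iota (v + size w2) (size w1)) /\ perm_eq w2 (iota v (size w2)).
Proof.
move=> pw le; have em : m = size w2 + size w1.
  by rewrite -(size_iota v m) -(perm_size pw) size_cat addnC.
have /eqP : sort leq w2 ++ sort leq w1 = iota v m.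
  apply: (sorted_eq leq_trans anti_leq).
  - rewrite (sorted_pairwise leq_trans) pairwise_cat -!(sorted_pairwise leq_trans).
    rewrite !(sort_sorted leq_total) !andbT.
    by apply/allrelP => y x; rewrite !mem_sort => yw xw; apply: le.
  - exact: iota_sorted.
  by apply: perm_trans pw; rewrite perm_catC; apply: perm_cat; rewrite perm_sort.
rewrite em iotaD eqseq_cat ?size_sort ?size_iota // => /andP[/eqP <- /eqP <-].
by rewrite !(perm_sym _ (sort _ _)) !perm_sort.
Qed.

(** * Monotone permutations and pattern containment *)

Definition increasing_on_classes (T : Type) (n : nat) (c : 'I_n -> T)
    (s : 'S_n) : Prop :=
  forall i j : 'I_n, c i = c j -> i < j -> s i < s j.

Lemma increasing_on_classes_eq1 (T : Type) (n : nat) (c : 'I_n -> T) (s : 'S_n) :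
  (forall i, c (s i) = c i) -> increasing_on_classes c s -> s = 1%g.
Proof.
move=> cs inc_s; apply/permP => i; rewrite perm1.
have [m] := ubnP (i : nat); elim: m i => // m IH i; rewrite ltnS => im.
have fixed (j : 'I_n) : j < i -> s j = j by move=> ji; apply/IH/(leq_trans ji).
have [|i_lt|/val_inj//] := ltngtP (s i) i; first by move/fixed/perm_inj.
have [k ki] : exists k, s k = i by exists (s^-1%g i); rewrite permKV.
have [k_lt|i_lt_k|/val_inj ek] := ltngtP k i.
- by move: (k_lt); rewrite -[in X in _ < X]ki (fixed _ k_lt) ltnn.
- have : c i = c k by rewrite -(cs k) ki.
  by move/inc_s => /(_ i_lt_k); rewrite ki ltnNge (ltnW i_lt).
by move: ki; rewrite ek => ->.
Qed.

Lemma increasing_on_classes_inj (T : Type) (n : nat) (c d : 'I_n -> T)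
    (s t : 'S_n) :
  (forall i, d (s i) = c i) -> (forall i, d (t i) = c i) ->
  increasing_on_classes c s -> increasing_on_classes c t -> s = t.
Proof.
move=> ds dt inc_s inc_t.
have cst i : c (t^-1%g (s i)) = c i by rewrite -dt permKV.
apply/eqP; rewrite eq_mulgV1; apply/eqP.
apply: (@increasing_on_classes_eq1 _ _ c); first by move=> i; rewrite permM cst.
move=> i j cij ij; rewrite !permM.
have [//|ji|/val_inj/perm_inj/perm_inj eij] := ltngtP (t^-1%g (s i)) (t^-1%g (s j)).
  have := inc_t _ _ _ ji; rewrite !permKV !cst => /(_ (esym cij)).
  by rewrite ltnNge (ltnW (inc_s _ _ cij ij)).
by rewrite eij ltnn in ij.
Qed.

(* Sends the k-th position of each letter in c to its k-th position in d. *)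
Lemma perm_eq_increasing_on_classes (T : eqType) (n : nat) (c d : n.-tuple T) :
  perm_eq c d ->
  exists2 s : 'S_n, (forall i, tnth d (s i) = tnth c i) &
    increasing_on_classes (tnth c) s.
Proof.
move=> pcd; pose cls (w : n.-tuple T) a := [seq i <- enum 'I_n | tnth w i == a].
have ltn_tr : transitive (fun i j : 'I_n => i < j) by move=> i j k; apply: ltn_trans.
have sorted_cls w a : sorted (fun i j : 'I_n => i < j) (cls w a).
  apply: sorted_filter ltn_tr _ _ _; have := iota_ltn_sorted 0 n.
  by rewrite -val_enum_ord sorted_map.
have size_cls a : size (cls c a) = size (cls d a).
  have size_clsE (w : n.-tuple T) : size (cls w a) = count_mem a w.
    by rewrite size_filter -[in RHS](map_tnth_enum w) count_map.
  by rewrite !size_clsE; apply/seq.permP.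
have mem_cls (i : 'I_n) : i \in cls c (tnth c i) by rewrite mem_filter eqxx mem_enum.
pose f (i : 'I_n) := nth i (cls d (tnth c i)) (index i (cls c (tnth c i))).
have index_lt (i : 'I_n) : index i (cls c (tnth c i)) < size (cls d (tnth c i)).
  by rewrite -size_cls index_mem.
have tnth_f i : tnth d (f i) = tnth c i.
  by have := mem_nth i (index_lt i); rewrite mem_filter => /andP[/eqP].
have inc_f (i j : 'I_n) : tnth c i = tnth c j -> i < j -> f i < f j.
  move=> cij ij; have mem_i : i \in cls c (tnth c j) by rewrite -cij.
  rewrite /f cij [nth j _ _](set_nth_default i) ?index_lt //.
  apply: (sorted_ltn_nth ltn_tr i (sorted_cls d _));
    rewrite ?inE -?size_cls ?index_mem //.
  have := sorted_ltn_index ltn_tr (sorted_cls c _) j i (mem_cls j) mem_i.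
  case: ltngtP => // [_ /(_ isT)|e _]; first by rewrite ltnNge (ltnW ij).
  by move: ij; rewrite -{1}(nth_index i mem_i) -e nth_index ?mem_cls // ltnn.
have inj_f : injective f.
  move=> i j e; have cij : tnth c i = tnth c j by rewrite -!tnth_f e.
  have [/(inc_f _ _ cij)|/(inc_f _ _ (esym cij))|/val_inj//] := ltngtP i j;
  by rewrite e ltnn.
exists (perm inj_f) => [i|i j cij ij]; first by rewrite permE.
by rewrite !permE; apply: inc_f.
Qed.

Lemma containsP (k n : nat) (tau : 'S_k) (s : 'S_n) :
  reflect (exists2 f : 'I_k -> 'I_n, {mono f : a b / a < b} &
             forall a b, (s (f a) < s (f b)) = (tau a < tau b))
          (contains tau s).
Proof.
apply: (iffP existsP) => [[f /andP[/forallP inc /forallP pat]]|[f mono pat]].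
  have {}inc (a b : 'I_k) : a < b -> f a < f b.
    by move=> ab; have /forallP/(_ b)/implyP := inc a; apply.
  exists f => a b; last by have /forallP/(_ b)/eqP := pat a.
  have [/inc//|/inc/ltnW|/val_inj->] := ltngtP a b; last by rewrite ltnn.
  by rewrite leqNgt => /negbTE.
exists (finfun f); apply/andP; split; apply/forallP => a; apply/forallP => b;
by rewrite !ffunE ?mono ?implybb ?pat.
Qed.

Lemma contains_same_size (k : nat) (s t : 'S_k) : contains t s = (s == t).
Proof.
apply/containsP/eqP => [[f mono pat]|->]; last by exists id.
have inj_f : injective f.
  move=> i j e; apply: val_inj; have := mono i j; have := mono j i.
  by rewrite e !ltnn; case: ltngtP.
have increasing_eq1 (r : 'S_k) : (forall i j : 'I_k, i < j -> r i < r j) -> r = 1%g.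
  move=> inc; apply: (@increasing_on_classes_eq1 _ _ (fun=> tt)) => // i j _.
  exact: inc.
have f_id i : f i = i.
  rewrite -[RHS]perm1 -(increasing_eq1 (perm inj_f)) ?permE // => a b.
  by rewrite !permE mono.
apply/eqP; rewrite eq_sym eq_mulVg1; apply/eqP/increasing_eq1 => i j ij.
by have := pat (t^-1%g i) (t^-1%g j); rewrite !f_id !permM !permKV ij.
Qed.

Lemma contains_permV (k n : nat) (tau : 'S_k) (s : 'S_n) :
  contains tau^-1%g s^-1%g = contains tau s.
Proof.
have contains_imp l m (t : 'S_l) (r : 'S_m) :
    contains t r -> contains t^-1%g r^-1%g.
  case/containsP=> f mono pat; apply/containsP; exists (fun a => r (f (t^-1%g a))).
    by move=> a b; rewrite pat !permKV.
  by move=> a b; rewrite !permK mono.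
by apply/idP/idP => /contains_imp //; rewrite !invgK.
Qed.

Definition rev_perm (n : nat) : 'S_n := perm (@rev_ord_inj n).

Lemma rev_permK (n : nat) : involutive (@rev_perm n).
Proof. by move=> i; rewrite !permE rev_ordK. Qed.

Lemma ltn_rev_perm (n : nat) (i j : 'I_n) : (rev_perm n i < rev_perm n j) = (j < i).
Proof. by rewrite !permE /=; have := ltn_ord i; have := ltn_ord j; lia. Qed.

Lemma contains_revJ (k n : nat) (tau : 'S_k) (s : 'S_n) :
  contains (tau ^ rev_perm k)%g (s ^ rev_perm n)%g = contains tau s.
Proof.
have revJE m (r : 'S_m) i : (r ^ rev_perm m)%g i = rev_perm m (r (rev_perm m i)).
  by rewrite -{1}[i]rev_permK permJ.
have contains_imp (t : 'S_k) (r : 'S_n) :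
    contains t r -> contains (t ^ rev_perm k)%g (r ^ rev_perm n)%g.
  case/containsP=> f mono pat; apply/containsP.
  exists (fun a => rev_perm n (f (rev_perm k a))) => a b.
    by rewrite ltn_rev_perm mono ltn_rev_perm.
  by rewrite !revJE !rev_permK !ltn_rev_perm pat.
have revJK m : involutive (conjg^~ (rev_perm m)).
  by move=> r; apply/permP => i; rewrite !revJE !rev_permK.
by apply/idP/idP => /contains_imp //; rewrite !revJK.
Qed.

(** * Symmetries of permutations *)

Definition preserves_stat (phi : forall n, 'S_n -> 'S_n) (st : perm_stat) : Prop :=
  forall n (s : 'S_n), st n (phi n s) = st n s.

Lemma wilf_equiv_injective (m : nat) (st : m.-tuple perm_stat) (k k' : nat)
    (tau : 'S_k) (tau' : 'S_k') (phi : forall n, 'S_n -> 'S_n) :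
  (forall n, injective (phi n)) ->
  (forall n (s : 'S_n), contains tau' (phi n s) = contains tau s) ->
  (forall i, preserves_stat phi (tnth st i)) ->
  wilf_equiv st tau tau'.
Proof.
move=> inj_phi cE stE n; rewrite /gen_poly [RHS](reindex_inj (inj_phi n)) /=.
apply: eq_big => [s|s _]; first by rewrite !inE cE.
by apply: eq_bigr => i _; rewrite stE.
Qed.

Definition rev_compl_inv (n : nat) (s : 'S_n) : 'S_n := (s^-1 ^ rev_perm n)%g.

Lemma rev_compl_inv_inj (n : nat) : injective (@rev_compl_inv n).
Proof. by move=> s t /conjg_inj/invg_inj. Qed.

Lemma rev_compl_invE (n : nat) (s : 'S_n) (i : 'I_n) :
  rev_compl_inv s (rev_perm n (s i)) = rev_perm n i.
Proof. by rewrite permJ permK. Qed.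

Lemma contains_rev_compl_inv (k n : nat) (tau : 'S_k) (s : 'S_n) :
  contains (rev_compl_inv tau) (rev_compl_inv s) = contains tau s.
Proof. by rewrite contains_revJ contains_permV. Qed.

Lemma rev_perm_comp_inj (n : nat) (s : 'S_n) : injective (fun i => rev_perm n (s i)).
Proof. by move=> i j /perm_inj/perm_inj. Qed.

Lemma fp_rev_compl_inv : preserves_stat rev_compl_inv st_fp.
Proof.
move=> n s; rewrite /st_fp -(card_preimset _ (rev_perm_comp_inj (s := s))).
by apply: eq_card => i; rewrite !inE rev_compl_invE (inj_eq perm_inj) eq_sym.
Qed.

Lemma exc_rev_compl_inv : preserves_stat rev_compl_inv st_exc.
Proof.
move=> n s; rewrite /st_exc -(card_preimset _ (rev_perm_comp_inj (s := s))).
by apply: eq_card => i; rewrite !inE rev_compl_invE ltn_rev_perm.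
Qed.

Definition inversion (n : nat) (s : 'S_n) (i j : 'I_n) : bool :=
  (i < j) && (s j < s i).

Lemma inv_rev_compl_inv : preserves_stat rev_compl_inv st_inv.
Proof.
move=> n s; apply: (card_pair_reindex (P := inversion _) (Q := inversion s)
  (rev_perm_comp_inj (s := s))) => i j.
by rewrite /inversion !rev_compl_invE !ltn_rev_perm andbC.
Qed.

Lemma crs_rev_compl_inv : preserves_stat rev_compl_inv st_crs.
Proof.
move=> n s; rewrite /st_crs -[RHS](card_pair_swap (crossing s)).
apply: (card_pair_reindex (P := crossing _) (Q := fun i j => crossing s j i)
  (rev_perm_comp_inj (s := s))) => i j.
by rewrite /crossing !rev_compl_invE !(leqNgt (rev_perm n _)) !ltn_rev_perm; lia.
Qed.

Lemma nes_rev_compl_inv : preserves_stat rev_compl_inv st_nes.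
Proof.
move=> n s; apply: (card_pair_reindex (P := nesting _) (Q := nesting s)
  (rev_perm_comp_inj (s := s))) => i j.
by rewrite /nesting !rev_compl_invE !(leqNgt (rev_perm n _)) !ltn_rev_perm; lia.
Qed.

Definition arcs_over (n : nat) (s : 'S_n) (p : nat) : nat :=
  \sum_(i < n) ((i < p) && (p <= s i)).

Lemma arcs_over_lower (n : nat) (s : 'S_n) (p : nat) :
  arcs_over s p = \sum_(i < n) ((p <= i) && (s i < p)).
Proof.
have card_lt : \sum_(i < n) (s i < p) = \sum_(i < n) (i < p).
  by rewrite [RHS](reindex_inj (@perm_inj _ s)).
apply/eqP; rewrite -(eqn_add2l (\sum_(i < n) ((i < p) && (s i < p)))); apply/eqP.
rewrite -!big_split /=.
transitivity (\sum_(i < n) (i < p)); first by apply: eq_bigr => i _; lia.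
by rewrite -card_lt; apply: eq_bigr => i _; lia.
Qed.

Lemma fp_permV : preserves_stat (fun n => @invg _) st_fp.
Proof.
move=> n s; rewrite /st_fp -(card_preimset _ (@perm_inj _ s)).
by apply: eq_card => i; rewrite !inE permK eq_sym.
Qed.

Lemma inv_permV : preserves_stat (fun n => @invg _) st_inv.
Proof.
move=> n s; rewrite /st_inv -[RHS](card_pair_swap (inversion s)).
apply: (card_pair_reindex (P := inversion _) (Q := fun i j => inversion s j i)
  (@perm_inj _ s)) => i j.
by rewrite /inversion !permK andbC.
Qed.

Lemma sum_pair_permV (n : nat) (s : 'S_n) (F : 'I_n -> 'I_n -> 'I_n -> 'I_n -> nat) :
  \sum_i \sum_j F i (s^-1%g i) j (s^-1%g j) = \sum_i \sum_j F (s i) i (s j) j.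
Proof.
rewrite (reindex_inj (@perm_inj _ s)); apply: eq_bigr => i _.
by rewrite (reindex_inj (@perm_inj _ s)); apply: eq_bigr => j _; rewrite !permK.
Qed.

Lemma sum_fixed_under_arcs (n : nat) (s : 'S_n) :
  \sum_(i < n) \sum_(j < n) [&& s i == i, i < j & s j < i] =
  \sum_(i < n) \sum_(j < n) [&& s i == i, i < s j & j < i].
Proof.
apply: eq_bigr => i _; have [si|_] := eqVneq (s i) i; last by rewrite !big1.
have fix_i (j : 'I_n) : s j = i :> nat -> j = i.
  by move/val_inj => e; apply: (@perm_inj _ s); rewrite e si.
transitivity (\sum_(j < n) ((i <= j) && (s j < i))).
  apply: eq_bigr => j _ /=; case: (ltngtP i j) => //= e.
  by rewrite -(val_inj e : i = j) si ltnn.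
rewrite -arcs_over_lower; apply: eq_bigr => j _ /=; have := fix_i j.
by case: (ltngtP i (s j)) => [||e /(_ (esym e))->]; rewrite ?ltnn ?andbT ?andbF.
Qed.

(* Inversion exchanges the upper nestings with the strict lower ones; the
   remaining nestings have a fixed point below an arc, and a fixed point lies
   below as many upper arcs as lower arcs. *)
Lemma nes_permV : preserves_stat (fun n => @invg _) st_nes.
Proof.
move=> n s.
pose upper (i a j b : 'I_n) : nat := [&& i < j, j < b & b < a].
pose lower (i a j b : 'I_n) : nat := [&& b < a, a < i & i < j].
pose fixed (i a j b : 'I_n) : nat := [&& a == i, i < j & b < i].
have nesE t : st_nes t = \sum_i \sum_j upper i (t i) j (t j) +
    \sum_i \sum_j lower i (t i) j (t j) + \sum_i \sum_j fixed i (t i) j (t j).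
  rewrite /st_nes (card_pair_sum (nesting t)) -!big_split; apply: eq_bigr => i _.
  rewrite -!big_split; apply: eq_bigr => j _.
  by rewrite /nesting /upper /lower /fixed -val_eqE /=; lia.
rewrite !nesE (sum_pair_permV s upper) (sum_pair_permV s lower).
rewrite (sum_pair_permV s fixed).
congr (_ + _); last first.
  rewrite [RHS]sum_fixed_under_arcs; apply: eq_bigr => i _; apply: eq_bigr => j _.
  by rewrite /fixed eq_sym; case: eqP => // ->.
by rewrite addnC; congr (_ + _); rewrite exchange_big; apply: eq_bigr => i _;
  apply: eq_bigr.
Qed.

Lemma wilf_equiv_stat (m : nat) (st : m.-tuple perm_stat) (k : nat)
    (s t : 'S_k) :
  wilf_equiv st s t -> forall i, tnth st i k s = tnth st i k t.
Proof.
move=> /(_ k); rewrite /gen_poly.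
pose mon (u : 'S_k) := [multinom tnth st i k u | i < m].
have gen_polyE (u : 'S_k) :
    (\sum_(v in avoiders u k) \prod_(i < m) 'X_i ^+ tnth st i k v =
     \sum_v 'X_[mon v] - 'X_[mon u] :> {mpoly int[m]})%R.
  rewrite [X in (X - _)%R](bigD1 u) //= [RHS]addrC addKr.
  apply: eq_big => [v|v _]; first by rewrite !inE contains_same_size.
  by rewrite mpolyXE_id; apply: eq_bigr => i _; rewrite mnmE.
rewrite !gen_polyE => /addrI/oppr_inj/(congr1 (mcoeff (mon t))).
rewrite !mcoeffX eqxx; case: eqP => // e _ i.
by have := congr1 (fun k : 'X_{1..m} => k i) e; rewrite !mnmE.
Qed.

(** * Patterns of length three *)

Lemma ord3_ind (P : 'I_3 -> Prop) :
  P (inord 0) -> P (inord 1) -> P (inord 2) -> forall i, P i.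
Proof.
move=> P0 P1 P2 [[|[|[|//]]] lt]; [move: P0|move: P1|move: P2];
by congr P; apply: val_inj; rewrite /= inordK.
Qed.

Lemma ltn_mono3 (h : 'I_3 -> nat) :
  h (inord 0) < h (inord 1) < h (inord 2) -> {mono h : a b / a < b}.
Proof. by move=> ?; apply: ord3_ind; apply: ord3_ind; rewrite !inordK //; lia. Qed.

Lemma one_lineVE (n : nat) (w : seq nat) (hw : perm_eq w (iota 1 n.+1))
    (i : 'I_n.+1) :
  (one_line hw)^-1%g i = index i.+1 w :> nat.
Proof.
rewrite -{2}[i](permKV (one_line hw)) one_lineE index_uniq //.
  by rewrite (perm_size hw) size_iota.
by rewrite (perm_uniq hw) iota_uniq.
Qed.

(* The positions of the values 1, 2, 3 of the pattern are read off its one-line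
   notation by index. *)
Lemma contains_one_line3P (n : nat) (w : seq nat) (hw : perm_eq w (iota 1 3))
    (s : 'S_n) :
  reflect (exists i j k : 'I_n, i < j < k /\
             let image a := s (nth i [:: i; j; k] (index a w)) in
             image 1 < image 2 < image 3)
          (contains (one_line hw) s).
Proof.
set tau := one_line hw.
have indexE a : a < 3 -> index a.+1 w = tau^-1%g (inord a).
  by move=> a3; rewrite one_lineVE inordK.
apply: (iffP (containsP _ _)) => [[f mono pat]|[i [j [k [ijk]]]]].
  exists (f (inord 0)), (f (inord 1)), (f (inord 2)).
  split; first by rewrite !mono !inordK.
  have nthE (m : 'I_3) :
      nth (f (inord 0)) [:: f (inord 0); f (inord 1); f (inord 2)] m = f m.
    by move: m; apply: ord3_ind; rewrite inordK.
  by rewrite /= !indexE // !nthE !pat !permKV !inordK.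
rewrite /= !indexE //; set f := nth i [:: i; j; k] => sorted_image.
exists (fun m : 'I_3 => f m); first by apply: ltn_mono3; rewrite /f !inordK.
have mono := ltn_mono3 (h := fun m => s (f (tau^-1%g m))) sorted_image.
by move=> a b; have := mono (tau a) (tau b); rewrite !permK.
Qed.

Lemma contains132P (n : nat) (s : 'S_n) :
  reflect (exists i j k : 'I_n, i < j < k /\ s i < s k < s j) (contains p132 s).
Proof. exact: (@contains_one_line3P n [:: 1; 3; 2] isT s). Qed.

Lemma contains321P (n : nat) (s : 'S_n) :
  reflect (exists i j k : 'I_n, i < j < k /\ s k < s j < s i) (contains p321 s).
Proof. exact: (@contains_one_line3P n [:: 3; 2; 1] isT s). Qed.

Lemma rev_compl_inv_p132 : rev_compl_inv p132 = p213.
Proof.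
suff e j : p213 (rev_perm 3 (p132 j)) = rev_perm 3 j.
  apply/permP => i; rewrite -[i](rev_permK (n := 3)) -[rev_perm 3 i](permKV p132).
  by rewrite rev_compl_invE e.
apply/val_inj/succn_inj.
rewrite /p213 one_lineE !(permE rev_ord_inj) /= /p132 one_lineE.
by move: j; apply: ord3_ind; rewrite !inordK.
Qed.

Lemma p231V : p231^-1%g = p312.
Proof.
apply/permP => i; apply/val_inj/succn_inj.
rewrite /= /p312 one_lineE /p231 one_lineVE.
by move: i; apply: ord3_ind; rewrite inordK.
Qed.

Lemma wilf_equiv_132_213 (m : nat) (st : m.-tuple perm_stat) :
  (forall i, preserves_stat rev_compl_inv (tnth st i)) -> wilf_equiv st p132 p213.
Proof.
apply: wilf_equiv_injective rev_compl_inv_inj _ => n s.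
by rewrite -rev_compl_inv_p132 contains_rev_compl_inv.
Qed.

Lemma wilf_equiv_231_312 (m : nat) (st : m.-tuple perm_stat) :
  (forall i, preserves_stat (fun n => @invg _) (tnth st i)) ->
  wilf_equiv st p231 p312.
Proof.
apply: wilf_equiv_injective (fun n => @invg_inj _) _ => n s.
by rewrite -p231V contains_permV.
Qed.

Lemma fp_one_line (n : nat) (w : seq nat) (hw : perm_eq w (iota 1 n.+1)) :
  st_fp (one_line hw) = \sum_(i < n.+1) (nth 0 w i == i.+1).
Proof.
rewrite /st_fp card_set_sum; apply: eq_bigr => i _.
by rewrite -val_eqE /= -one_lineE eqSS.
Qed.

Lemma inv_one_line (n : nat) (w : seq nat) (hw : perm_eq w (iota 1 n.+1)) :
  st_inv (one_line hw) =
  \sum_(i < n.+1) \sum_(j < n.+1) ((i < j) && (nth 0 w j < nth 0 w i)).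
Proof.
rewrite /st_inv (card_pair_sum (inversion _)); apply: eq_bigr => i _.
by apply: eq_bigr => j _; rewrite -!one_lineE ltnS.
Qed.

Lemma one_line_inord (w : seq nat) (hw : perm_eq w (iota 1 3)) (i : nat) :
  i < 3 -> one_line hw (inord i) = (nth 0 w i).-1 :> nat.
Proof. by move=> i3; have := one_lineE hw (inord i); rewrite inordK // => <-. Qed.

Definition p123 : 'S_3 := @one_line 2 [:: 1; 2; 3] isT.

Lemma mem_perms3 (s : 'S_3) : s \in [:: p123; p132; p213; p231; p312; p321].
Proof.
set perms := [:: _; _; _; _; _; _].
have perms_uniq : uniq perms.
  apply: (@map_uniq _ _ (fun s : 'S_3 => (val (s (inord 0)), val (s (inord 1))))).
  by rewrite /= !one_line_inord.
have /subset_cardP/(_ (subset_predT _)) -> // : #|perms| = #|{: 'S_3}|.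
by rewrite (card_uniqP perms_uniq) card_Sn.
Qed.

Lemma fp_p132 : st_fp p132 = 1.
Proof. by rewrite fp_one_line !big_ord_recl big_ord0. Qed.

Lemma fp_p231 : st_fp p231 = 0.
Proof. by rewrite fp_one_line !big_ord_recl big_ord0. Qed.

Lemma inv_p132_neq_p321 : st_inv p132 != st_inv p321.
Proof. by rewrite !inv_one_line !big_ord_recl !big_ord0. Qed.

Lemma fp_eq1_perms3 (s : 'S_3) : st_fp s = 1 -> s \in [set p132; p213; p321].
Proof.
have := mem_perms3 s; rewrite !inE.
by do 5?case/predU1P=> [->|]; last move/eqP->;
  rewrite ?eqxx ?orbT // fp_one_line !big_ord_recl big_ord0.
Qed.

Lemma fp_eq0_perms3 (s : 'S_3) : st_fp s = 0 -> s \in [set p231; p312].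
Proof.
have := mem_perms3 s; rewrite !inE.
by do 5?case/predU1P=> [->|]; last move/eqP->;
  rewrite ?eqxx ?orbT // fp_one_line !big_ord_recl big_ord0.
Qed.

(** * Weighted Motzkin paths *)

(* A level step at height 0 has weight x, one at height h.+1 comes in two
   colours of weights t q^h and q^(h+1). *)
Definition motzkin_transfer (R : comNzRingType) (x t q : R) (A : nat -> R)
    (h : nat) : R :=
  (q ^+ h * A h.+1 +
   (if h is h'.+1 then (t * q ^+ h' + q ^+ h) * A h + t * q ^+ h' * A h'
    else x * A 0))%R.

(* A step (a, b) goes up if a, then down if b: (true, true) and (false, false)
   are the two colours of level steps. *)
Definition step : Type := (bool * bool)%type.

Definition height (w : seq step) : nat :=
  count (fun c : step => c.1) w - count (fun c : step => c.2) w.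

Definition motzkin_path (w : seq step) : bool :=
  all (fun p => (nth (false, false) w p).2 ==> (0 < height (take p w)))
    (iota 0 (size w)).

Lemma motzkin_path_rcons (w : seq step) (c : step) :
  motzkin_path (rcons w c) = motzkin_path w && (c.2 ==> (0 < height w)).
Proof.
rewrite /motzkin_path size_rcons -[(size w).+1]addn1 iotaD all_cat /= andbT.
rewrite nth_rcons ltnn eqxx -cats1 take_size_cat //; congr (_ && _).
apply: eq_in_all => p; rewrite mem_iota add0n => /andP[_ pw].
by rewrite nth_cat pw takel_cat // ltnW.
Qed.

Lemma motzkin_path_take (w : seq step) (p : nat) :
  motzkin_path w -> motzkin_path (take p w).
Proof.
elim/last_ind: w => // w c IH path_wc.
have := path_wc; rewrite motzkin_path_rcons => /andP[/IH path_w _].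
have [pw|wp] := leqP p (size w); first by rewrite -cats1 takel_cat.
by rewrite take_oversize // size_rcons.
Qed.

Lemma motzkin_path_count (w : seq step) : motzkin_path w ->
  count (fun c : step => c.2) w <= count (fun c : step => c.1) w.
Proof.
elim/last_ind: w => // w c IH; rewrite motzkin_path_rcons -cats1 !count_cat /=.
by move=> /andP[/IH]; rewrite /height; case: c => [[] []] /=; lia.
Qed.

Lemma height_rcons (w : seq step) (c : step) : motzkin_path (rcons w c) ->
  height (rcons w c) = height w + c.1 - c.2.
Proof.
rewrite motzkin_path_rcons => /andP[/motzkin_path_count].
by rewrite /height -cats1 !count_cat /=; case: c => [[] []] /=; lia.
Qed.

Section MotzkinWeight.

Variables (R : comNzRingType) (x t q : R).
Local Open Scope ring_scope.

Definition step_weight (c : step) (h : nat) : R :=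
  x ^+ [&& ~~ c.1, ~~ c.2 & h == 0%N] * t ^+ c.2 * q ^+ (h - c.2).

Definition motzkin_weight (w : seq step) : R :=
  \prod_(p < size w) step_weight (nth (false, false) w p) (height (take p w)).

Lemma motzkin_weight_rcons (w : seq step) (c : step) :
  motzkin_weight (rcons w c) = motzkin_weight w * step_weight c (height w).
Proof.
rewrite /motzkin_weight size_rcons big_ord_recr /=.
rewrite nth_rcons ltnn eqxx -cats1 take_size_cat //; congr (_ * _).
apply: eq_bigr => p _; rewrite nth_cat ltn_ord takel_cat // ltnW //; exact: ltn_ord.
Qed.

Lemma sum_step_weight (A : nat -> R) (h : nat) :
  \sum_(c : step | c.2 ==> (0 < h)%N) step_weight c h * A (h + c.1 - c.2)%N =
  motzkin_transfer x t q A h.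
Proof.
rewrite big_mkcond big_bool_pair /step_weight /motzkin_transfer /=.
case: h => [|h] /=; rewrite ?subn1 ?subn0 ?addn1 ?addn0 ?expr0 ?expr1 /=; ring.
Qed.

Lemma sum_motzkin_weight (n : nat) (A : nat -> R) :
  \sum_(w : n.-tuple step | motzkin_path w) motzkin_weight w * A (height w) =
  iter n (motzkin_transfer x t q) A 0%N.
Proof.
elim: n A => [|n IH] A.
  rewrite (big_pred1 [tuple]) => [|w]; first by rewrite /motzkin_weight big_ord0 mul1r.
  by rewrite (tuple0 w) /= eqxx.
rewrite iterSr -IH big_mkcond [RHS]big_mkcond.
rewrite (big_tuple_rcons _ (fun w : seq step =>
  if motzkin_path w then motzkin_weight w * A (height w) else 0)).
apply: eq_bigr => w _; rewrite -big_mkcond /=.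
under eq_bigl do rewrite motzkin_path_rcons.
case: (boolP (motzkin_path w)) => [pw|_]; last by rewrite big_pred0.
rewrite -sum_step_weight big_distrr; apply: eq_bigr => c /= pc.
by rewrite motzkin_weight_rcons height_rcons ?motzkin_path_rcons ?pw // mulrA.
Qed.

Lemma motzkin_weightE (w : seq step) :
  motzkin_weight w =
  x ^+ (\sum_(p < size w) [&& ~~ (nth (false, false) w p).1,
          ~~ (nth (false, false) w p).2 & height (take p w) == 0%N]) *
  t ^+ (\sum_(p < size w) (nth (false, false) w p).2) *
  q ^+ (\sum_(p < size w) (height (take p w) - (nth (false, false) w p).2)).
Proof. by rewrite -!prodrXr -!big_split. Qed.

End MotzkinWeight.

(** * Permutations avoiding 321 *)

Lemma increasing_on_classes_rank (T : eqType) (n : nat) (c d : 'I_n -> T)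
    (s : 'S_n) (i : 'I_n) :
  (forall i, d (s i) = c i) -> increasing_on_classes c s ->
  \sum_(v < n) ((d v == c i) && (v < s i)) = \sum_(j < n) ((c j == c i) && (j < i)).
Proof.
move=> ds inc_s; rewrite (reindex_inj (@perm_inj _ s)); apply: eq_bigr => j _.
rewrite ds; case: eqP => //= cji; have := inc_s i j (esym cji); have := inc_s j i cji.
case: (ltngtP j i) => [_ ->|_ _ /(_ isT)/ltnW|/val_inj-> _ _]; rewrite ?ltnn //.
by rewrite leqNgt => /negbTE->.
Qed.

Lemma arcs_over_gt0P (n : nat) (s : 'S_n) (p : nat) :
  reflect (exists i : 'I_n, i < p <= s i) (0 < arcs_over s p).
Proof.
rewrite lt0n sum_nat_eq0; apply: (iffP forallPn) => -[i h]; exists i; move: h; lia.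
Qed.

Lemma lower_arcs_over_gt0P (n : nat) (s : 'S_n) (p : nat) :
  reflect (exists i : 'I_n, s i < p <= i) (0 < arcs_over s p).
Proof.
rewrite arcs_over_lower lt0n sum_nat_eq0.
by apply: (iffP forallPn) => -[i h]; exists i; move: h; lia.
Qed.

Lemma perm_ord_neq (n : nat) (s : 'S_n) (i j : 'I_n) :
  i != j :> nat -> s i != s j :> nat.
Proof. by apply: contra => /eqP/val_inj/perm_inj->. Qed.

Lemma avoids321_increasing (n : nat) (s : 'S_n) :
  ~~ contains p321 s -> increasing_on_classes (fun i : 'I_n => i < s i) s.
Proof.
move=> av i j cij ij; rewrite ltnNge; apply/negP => sji.
have sij : s i != s j :> nat by apply: perm_ord_neq; rewrite ltn_eqF.
have no321 (a b c : 'I_n) : a < b < c -> s c < s b < s a -> False.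
  by move=> abc sabc; apply/(negP av)/contains321P; exists a, b, c.
have [ei|nei] := ltnP i (s i).
  have [|k kj] := lower_arcs_over_gt0P s j.+1 _.
    by apply/arcs_over_gt0P; exists j; rewrite ltnSn -cij ei.
  by apply: (no321 i j k); lia.
have [|k ki] := arcs_over_gt0P s (s i) _.
  by apply/lower_arcs_over_gt0P; exists j; lia.
have : s k != s i :> nat by apply: perm_ord_neq; lia.
by move=> ski; apply: (no321 k i j); lia.
Qed.

Lemma increasing_avoids321 (n : nat) (c : 'I_n -> bool) (s : 'S_n) :
  increasing_on_classes c s -> ~~ contains p321 s.
Proof.
move=> inc_s; apply/contains321P => -[i [j [k [/andP[ij jk] sijk]]]].
have [e|[e|e]] : c i = c j \/ c j = c k \/ c i = c k.
- by case: (c i); case: (c j); case: (c k); auto.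
- by have := inc_s i j e ij; lia.
- by have := inc_s j k e jk; lia.
by have := inc_s i k e (ltn_trans ij jk); lia.
Qed.

Definition exc_word (n : nat) (s : 'S_n) : n.-tuple step :=
  [tuple (i < s i, s^-1%g i < i) | i < n].

Lemma nth_exc_word (n : nat) (s : 'S_n) (i : 'I_n) :
  nth (false, false) (exc_word s) i = (i < s i, s^-1%g i < i).
Proof. by rewrite -tnth_nth tnth_mktuple. Qed.

Lemma height_exc_word (n : nat) (s : 'S_n) (p : nat) :
  height (take p (exc_word s)) = arcs_over s p.
Proof.
rewrite /height !(count_take_sum (false, false)) size_tuple.
rewrite [X in _ - X](reindex_inj (@perm_inj _ s)).
set values := (X in _ - X); rewrite -[RHS](addKn values); congr (_ - _).
rewrite -big_split; apply: eq_bigr => i _.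
by rewrite !nth_exc_word permK /=; lia.
Qed.

Lemma exc_word_motzkin (n : nat) (s : 'S_n) : motzkin_path (exc_word s).
Proof.
apply/allP => p; rewrite mem_iota size_tuple => /andP[_ pn].
rewrite height_exc_word (nth_exc_word s (Ordinal pn)); apply/implyP => /= exc_p.
by apply/arcs_over_gt0P; exists (s^-1%g (Ordinal pn)); rewrite permKV exc_p leqnn.
Qed.

Lemma height_exc_word_eq0 (n : nat) (s : 'S_n) : height (exc_word s) = 0.
Proof.
rewrite -[exc_word s : seq _]take_size size_tuple height_exc_word /arcs_over.
by rewrite big1 // => i _; rewrite ltn_ord leqNgt ltn_ord.
Qed.

Lemma exc_word_inj (n : nat) : {in avoiders p321 n &, injective (@exc_word n)}.
Proof.
move=> s t; rewrite !inE => /avoids321_increasing inc_s /avoids321_increasing inc_t e.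
have wE (i : 'I_n) : (i < s i, s^-1%g i < i) = (i < t i, t^-1%g i < i).
  by rewrite -!nth_exc_word e.
apply: (increasing_on_classes_inj (c := fun i : 'I_n => i < s i)
  (d := fun v : 'I_n => s^-1%g v < v)) => //.
- by move=> i; rewrite permK.
- by move=> i; case: (wE i) (wE (t i)) => -> _ [_ ->]; rewrite permK.
by move=> i j; case: (wE i) (wE j) => -> _ [-> _]; apply: inc_t.
Qed.

Lemma exc_of_motzkin_path (n : nat) (w : n.-tuple step) (s : 'S_n) :
  motzkin_path w -> (forall i, (tnth w (s i)).2 = (tnth w i).1) ->
  increasing_on_classes (fun i => (tnth w i).1) s ->
  forall i : 'I_n, (i < s i) = (tnth w i).1.
Proof.
move=> path_w ws inc_s i.
pose num (f : pred step) b p := count (fun c => f c == b) (take p w).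
pose up : pred step := fun c => c.1; pose down : pred step := fun c => c.2.
have numT f p : num f true p = count f (take p w).
  by apply: eq_count => c; rewrite eqb_id.
have num_total f p : num f true p + num f false p = size (take p w).
  rewrite numT -(count_predC f); congr (_ + _).
  by apply: eq_count => c /=; case: (f c).
have rank : num down (tnth w i).1 (s i) = num up (tnth w i).1 i.
  rewrite /num !(count_take_sum (false, false)) size_tuple.
  under eq_bigr do rewrite -tnth_nth; under [RHS]eq_bigr do rewrite -tnth_nth.
  exact: (increasing_on_classes_rank (d := fun v => (tnth w v).2)).
have num_le p : num down true p <= num up true p.
  by rewrite !numT; apply/motzkin_path_count/motzkin_path_take.
case wi : (tnth w i).1 rank => rank.
- rewrite ltnNge; apply/negP => si_le_i.
  have : num down true (s i) < num up true (s i).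
    have /allP/(_ (s i)) := path_w.
    rewrite mem_iota size_tuple ltn_ord -tnth_nth ws wi => /(_ isT).
    by rewrite /= /height subn_gt0 !numT.
  by rewrite rank ltnNge (leq_count_take _ _ si_le_i).
apply/negbTE/negP => i_lt_si.
have : num up false i < num up false (s i).
  apply: (ltn_count_take (x0 := (false, false)) i_lt_si); first by rewrite size_tuple.
  by rewrite -tnth_nth /up wi.
have := num_le (s i); have := num_total up (s i); have := num_total down (s i).
by rewrite -rank; lia.
Qed.

Lemma exc_word_surj (n : nat) (w : n.-tuple step) :
  motzkin_path w -> height w = 0 ->
  exists2 s : 'S_n, s \in avoiders p321 n & exc_word s = w.
Proof.
move=> path_w height_w.
have [s ws inc_s] : exists2 s : 'S_n, (forall i, (tnth w (s i)).2 = (tnth w i).1) &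
    increasing_on_classes (fun i => (tnth w i).1) s.
  have [|s ws inc_s] := @perm_eq_increasing_on_classes _ n
    [tuple of map fst w] [tuple of map snd w].
    apply: perm_eq_bool; first by rewrite !size_map.
    rewrite !count_map; apply/anti_leq/andP; split; last exact: motzkin_path_count.
    by rewrite -subn_eq0; apply/eqP.
  exists s => [i|i j wij]; first by have := ws i; rewrite !tnth_map.
  by apply: inc_s; rewrite !tnth_map.
have excE := exc_of_motzkin_path path_w ws inc_s.
exists s; first by rewrite inE (increasing_avoids321 inc_s).
apply: eq_from_tnth => i; rewrite tnth_mktuple excE.
have := excE (s^-1%g i); rewrite permKV => ->.
by rewrite -[(tnth w (s^-1%g i)).1]ws permKV; case: (tnth w i).
Qed.

Section ExcWordStatistics.

Variables (n : nat) (s : 'S_n).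
Hypothesis av : ~~ contains p321 s.

Let inc_s : increasing_on_classes (fun i : 'I_n => i < s i) s.
Proof. exact: avoids321_increasing. Qed.

Lemma fp_exc_word : st_fp s =
  \sum_(p < n) [&& ~~ (nth (false, false) (exc_word s) p).1,
                   ~~ (nth (false, false) (exc_word s) p).2 &
                   height (take p (exc_word s)) == 0].
Proof.
rewrite /st_fp card_set_sum; apply: eq_bigr => p _.
rewrite nth_exc_word height_exc_word -val_eqE /=; congr nat_of_bool.
apply/eqP/and3P => [|[not_exc _ /eqP no_arc]].
  move/val_inj => sp; rewrite -{3}sp permK sp ltnn; split=> //.
  rewrite eqn0Ngt; apply/negP => arc.
  have [j /andP[sjp pj]] := lower_arcs_over_gt0P s p arc.
  have : p < j.
    rewrite ltn_neqAle pj andbT; apply: contraTneq sjp => /val_inj<-.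
    by rewrite sp ltnn.
  by move=> /(@inc_s p j); rewrite sp; lia.
have [sp|ps|//] := ltngtP (s p) p; last by rewrite ps in not_exc.
have : 0 < arcs_over s p by apply/lower_arcs_over_gt0P; exists p; rewrite sp leqnn.
by rewrite no_arc.
Qed.

Lemma exc_exc_word :
  st_exc s = \sum_(p < n) (nth (false, false) (exc_word s) p).2.
Proof.
rewrite /st_exc card_set_sum [RHS](reindex_inj (@perm_inj _ s)).
by apply: eq_bigr => i _; rewrite nth_exc_word permK.
Qed.

Lemma crs_exc_word : st_crs s =
  \sum_(p < n) (height (take p (exc_word s)) - (nth (false, false) (exc_word s) p).2).
Proof.
pose upper (i j : 'I_n) : nat := [&& i < j, j < s i & s i < s j].
pose lower (i j : 'I_n) : nat := [&& s j < s i, s i <= j & j < i].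
have -> : st_crs s = \sum_i \sum_j (upper i j + lower i j).
  transitivity (\sum_i \sum_j (upper i j + lower j i)).
    rewrite /st_crs (card_pair_sum (crossing s)); apply: eq_bigr => i _.
    by apply: eq_bigr => j _; rewrite /crossing /upper /lower; lia.
  under eq_bigr do rewrite big_split; under [RHS]eq_bigr do rewrite big_split.
  by rewrite !big_split; congr (_ + _); rewrite exchange_big.
rewrite [RHS](reindex_inj (@perm_inj _ s)); apply: eq_bigr => i _ /=.
rewrite nth_exc_word permK height_exc_word /=.
have neq j : j != i -> s j != s i :> nat by rewrite -val_eqE; apply: perm_ord_neq.
have [i_exc|i_nexc] := ltnP i (s i).
  rewrite /arcs_over [in RHS](bigD1 i) //= i_exc leqnn addKn.
  rewrite (bigD1 i) //= {1}/upper {1}/lower !ltnn !andbF add0n.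
  apply: eq_bigr => j nji; have := neq j nji; have := @inc_s j i; have := @inc_s i j.
  by move: nji; rewrite -val_eqE /upper /lower /=; lia.
rewrite subn0 arcs_over_lower; apply: eq_bigr => j _.
have [->|nji] := eqVneq j i; first by rewrite /upper /lower; lia.
have := neq j nji; have := @inc_s j i; have := @inc_s i j.
by move: nji; rewrite -val_eqE /upper /lower /=; lia.
Qed.

End ExcWordStatistics.

Lemma sum_avoiders321 (R : comNzRingType) (x t q : R) (n : nat) :
  (\sum_(s in avoiders p321 n) x ^+ st_fp s * t ^+ st_exc s * q ^+ st_crs s =
   iter n (motzkin_transfer x t q) (fun h => (h == 0)%:R) 0)%R.
Proof.
rewrite -sum_motzkin_weight [RHS]big_mkcond /=.
transitivity (\sum_(w in @exc_word n @: avoiders p321 n) motzkin_weight x t q w)%R.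
  rewrite (big_imset _ (@exc_word_inj n)); apply: eq_bigr => s; rewrite inE => av.
  rewrite motzkin_weightE size_tuple.
  by rewrite -fp_exc_word // -exc_exc_word -crs_exc_word.
rewrite big_mkcond; apply: eq_bigr => w _.
have [/imsetP[s _ ->]|notin] := boolP (w \in _).
  by rewrite exc_word_motzkin height_exc_word_eq0 mulr1.
case: ifP => // path_w; case: eqP => [height_w|_]; last by rewrite mulr0.
have [s av e] := exc_word_surj path_w height_w.
by case/imsetP: notin; exists s.
Qed.

(** * Walks in the bicyclic monoid *)

(* (a, b) stands for the lattice path with a down steps
   followed by b up steps, the normal form of a path after the cancellation of
   its matched steps (true is an up step). *)
Definition bicyclic_mul (u v : nat * nat) : nat * nat :=
  (u.1 + (v.1 - u.2), v.2 + (u.2 - v.1)).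

Definition unmatched1 (c : bool) : nat * nat := if c then (0, 1) else (1, 0).

Definition unmatched (w : seq bool) : nat * nat :=
  foldr (fun c => bicyclic_mul (unmatched1 c)) (0, 0) w.

Lemma bicyclic_mulA : associative bicyclic_mul.
Proof. by move=> [a b] [c d] [e f]; rewrite /bicyclic_mul /=; congr pair; lia. Qed.

Lemma bicyclic_mul1u : left_id (0, 0) bicyclic_mul.
Proof. by move=> [a b]; rewrite /bicyclic_mul /= subn0 addn0. Qed.

Lemma bicyclic_mulu1 : right_id (0, 0) bicyclic_mul.
Proof. by move=> [a b]; rewrite /bicyclic_mul /= addn0 subn0. Qed.

Lemma unmatched_cat (v w : seq bool) :
  unmatched (v ++ w) = bicyclic_mul (unmatched v) (unmatched w).
Proof. by elim: v => [|c v IH] /=; rewrite ?bicyclic_mul1u // IH bicyclic_mulA. Qed.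

Lemma unmatched_seq1 (c : bool) : unmatched [:: c] = unmatched1 c.
Proof. exact: bicyclic_mulu1. Qed.

Lemma odd_unmatched (w : seq bool) :
  odd ((unmatched w).1 + (unmatched w).2) = odd (size w).
Proof.
elim: w => //= c w; case: (unmatched w) => a b /= <-.
by case: c; rewrite /bicyclic_mul /=; lia.
Qed.

Definition factor (T : Type) (w : seq T) (i j : nat) : seq T := drop i (take j w).

Lemma factor_cat (T : Type) (v w : seq T) (i j : nat) :
  factor (v ++ w) i j = factor v i j ++ factor w (i - size v) (j - size v).
Proof.
rewrite /factor take_cat; case: ltnP => jn.
  by rewrite (eqP (ltnW jn : j - size v == 0)) take0 cats0.
rewrite (take_oversize jn) drop_cat; case: ltnP => // ni.
  by rewrite (eqP (ltnW ni : i - size v == 0)) drop0.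
by rewrite (drop_oversize ni).
Qed.

Lemma factor_cons (T : Type) (x0 : T) (w : seq T) (x y : nat) :
  x < y -> y <= size w -> factor w x y = nth x0 w x :: factor w x.+1 y.
Proof.
by move=> xy yw; rewrite /factor (drop_nth x0) ?nth_take // size_takel.
Qed.

Lemma factor_rcons (T : Type) (x0 : T) (w : seq T) (x y : nat) :
  x <= y -> y < size w -> factor w x y.+1 = rcons (factor w x y) (nth x0 w y).
Proof.
move=> xy yw; rewrite /factor (take_nth x0) // drop_rcons // size_takel //.
exact: ltnW.
Qed.

Section OutwardWalk.

Variables (R : comNzRingType) (x t q : R).
Local Open Scope ring_scope.

Definition extension_weight (c d : bool) (u : nat * nat) : R :=
  x ^+ [&& c, ~~ d & u == (0, 0)%N] * t ^+ (c && (0 < u.1)%N) *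
  q ^+ ((u.1 + u.2)./2 - (c && (0 < u.1)%N)).

(* The word is read outwards from its middle, one letter on each side at a time. *)
Definition outward_weight (n : nat) (w : seq bool) : R :=
  \prod_(p < n) extension_weight (nth false w (n - p.+1)) (nth false w (n + p))
    (unmatched (factor w (n - p) (n + p))).

Lemma outward_weight_extend (n : nat) (c d : bool) (w : seq bool) :
  size w = n.*2 ->
  outward_weight n.+1 (c :: rcons w d) =
  outward_weight n w * extension_weight c d (unmatched w).
Proof.
move=> sw; rewrite /outward_weight big_ord_recr /=; congr (_ * _).
  apply: eq_bigr => p _; have pn := ltn_ord p; rewrite !subSS addSn /=.
  have -> : (n.+1 - p = (n - p.+1).+2)%N by lia.
  have -> : (n - p = (n - p.+1).+1)%N by lia.
  have [lt1 lt2] : (n - p.+1 < n.*2)%N /\ (n + p < n.*2)%N by lia.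
  rewrite /= !nth_rcons sw lt1 lt2; congr extension_weight; congr unmatched.
  by rewrite /factor /= -cats1 takel_cat ?sw ?(ltnW lt2).
rewrite subnn subSn // subnn addSn /= nth_rcons addnn sw ltnn eqxx.
by rewrite /factor /= -cats1 take_size_cat ?sw // drop0.
Qed.

Definition antidiagonal_sum (phi : nat * nat -> R) (m : nat) : R :=
  \sum_(a < m.+1) phi (val a, m - a)%N.

Lemma antidiagonal_sum_left (alpha beta : R) (phi : nat * nat -> R) (m : nat) :
  antidiagonal_sum (fun u =>
    (if (0 < u.1)%N then alpha else beta) * phi (bicyclic_mul (unmatched1 true) u) +
    beta * phi (bicyclic_mul (unmatched1 false) u)) m =
  beta * antidiagonal_sum phi m.+1 +
  (if m is m'.+1 then alpha * antidiagonal_sum phi m' else 0).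
Proof.
rewrite /antidiagonal_sum big_split /= -mulr_sumr.
have -> : \sum_(a < m.+2) phi (val a, m.+1 - a)%N =
    phi (0, m.+1)%N +
    \sum_(a < m.+1) phi (bicyclic_mul (unmatched1 false) (val a, m - a)%N).
  rewrite big_ord_recl subn0; congr (_ + _); apply: eq_bigr => a _.
  by rewrite /bicyclic_mul /= subn0 addn0.
rewrite mulrDr addrAC; congr (_ + _); rewrite big_ord_recl /=; congr (_ * _ + _).
  by rewrite /bicyclic_mul /= subn0 addn1.
case: m => [|m]; first by rewrite big_ord0.
rewrite mulr_sumr; apply: eq_bigr => a _.
by rewrite /bicyclic_mul /= /bump add1n subSS subn0 addn0.
Qed.

Lemma antidiagonal_sum_right (phi : nat * nat -> R) (m : nat) :
  antidiagonal_sum (fun u => phi (bicyclic_mul u (unmatched1 true)) +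
                             phi (bicyclic_mul u (unmatched1 false))) m =
  antidiagonal_sum phi m.+1 + (if m is m'.+1 then antidiagonal_sum phi m' else 0).
Proof.
rewrite /antidiagonal_sum big_split /=.
rewrite [in RHS]big_ord_recr /= -addrA; congr (_ + _).
  apply: eq_bigr => a _.
  by rewrite /bicyclic_mul /= sub0n addn0 subn0 add1n -subSn // -ltnS.
rewrite big_ord_recr /= addrC; congr (_ + _).
  by rewrite /bicyclic_mul /= !subnn addn1.
case: m => [|m]; first by rewrite big_ord0.
apply: eq_bigr => a _; have am := ltn_ord a.
by rewrite /bicyclic_mul /=; congr (phi (_, _)); lia.
Qed.

Definition extension_transfer (phi : nat * nat -> R) (u : nat * nat) : R :=
  \sum_(cd : bool * bool) extension_weight cd.1 cd.2 u *
     phi (bicyclic_mul (bicyclic_mul (unmatched1 cd.1) u) (unmatched1 cd.2)).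

(* The uniform distribution on each antidiagonal is preserved by the walk. *)
Lemma antidiagonal_sum_transfer (phi : nat * nat -> R) (h : nat) :
  antidiagonal_sum (extension_transfer phi) h.*2 =
  motzkin_transfer x t q (fun k => antidiagonal_sum phi k.*2) h.
Proof.
case: h => [|h].
  rewrite /motzkin_transfer /antidiagonal_sum -[1.*2]/2%N -[0.*2]/0%N.
  rewrite !big_ord_recl !big_ord0 /extension_transfer big_bool_pair.
  by rewrite /extension_weight /bicyclic_mul /= /bump /= !expr0 !expr1; ring.
pose right_phi u := phi (bicyclic_mul u (unmatched1 true)) +
                    phi (bicyclic_mul u (unmatched1 false)).
transitivity (antidiagonal_sum (fun u =>
    (if (0 < u.1)%N then t * q ^+ h else q ^+ h.+1) *
       right_phi (bicyclic_mul (unmatched1 true) u) +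
    q ^+ h.+1 * right_phi (bicyclic_mul (unmatched1 false) u)) h.+1.*2).
  apply: eq_bigr => a _; have := ltn_ord a; rewrite ltnS => ah.
  rewrite /extension_transfer big_bool_pair /extension_weight /right_phi /=.
  have -> : ((a + (h.+1.*2 - a))./2 = h.+1)%N by rewrite subnKC // doubleK.
  have -> : ((val a, h.+1.*2 - a)%N == (0, 0)%N) = false.
    by rewrite xpair_eqE /=; lia.
  by case: (0 < a)%N => /=; rewrite ?andbF ?expr0 ?expr1 ?subn0 ?subn1 /=; ring.
rewrite antidiagonal_sum_left doubleS /= !antidiagonal_sum_right.
by rewrite /motzkin_transfer /= !doubleS; ring.
Qed.

Lemma sum_outward_weight (n : nat) (phi : nat * nat -> R) (A : nat -> R) :
  (forall h, antidiagonal_sum phi h.*2 = A h) ->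
  \sum_(w : n.*2.-tuple bool) outward_weight n w * phi (unmatched w) =
  iter n (motzkin_transfer x t q) A 0%N.
Proof.
elim: n phi A => [|n IH] phi A phiA.
  rewrite (big_pred1 [tuple]) => [|w]; last by rewrite (tuple0 w) /= eqxx.
  by rewrite /= -phiA /outward_weight /antidiagonal_sum big_ord0 big_ord1 mul1r.
transitivity (\sum_(w : n.*2.-tuple bool)
    outward_weight n w * extension_transfer phi (unmatched w)).
  rewrite (big_tuple_cons _ (fun w => outward_weight n.+1 w * phi (unmatched w))).
  under eq_bigr do rewrite (big_tuple_rcons _ (fun w =>
    outward_weight n.+1 (_ :: w) * phi (unmatched (_ :: w)))).
  under eq_bigr do rewrite exchange_big; rewrite pair_bigA exchange_big /=.
  apply: eq_bigr => w _; rewrite mulr_sumr; apply: eq_bigr => -[c d] _ /=.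
  rewrite outward_weight_extend ?size_tuple // -mulrA.
  by rewrite -cats1 unmatched_cat unmatched_seq1 bicyclic_mulA.
rewrite iterSr; apply: IH => h; rewrite antidiagonal_sum_transfer.
by rewrite /motzkin_transfer; case: h => [|h]; rewrite !phiA.
Qed.

End OutwardWalk.

(** * Binary trees and Dyck words *)

Inductive bintree : Type := Leaf | Node of bintree & bintree.

Fixpoint tree_size (t : bintree) : nat :=
  if t is Node l r then (tree_size l + tree_size r).+1 else 0.

Fixpoint dyck_word (t : bintree) : seq bool :=
  if t is Node l r then true :: dyck_word l ++ false :: dyck_word r else [::].

Lemma size_dyck_word (t : bintree) : size (dyck_word t) = (tree_size t).*2.
Proof. by elim: t => //= l IHl r IHr; rewrite size_cat /= IHl IHr; lia. Qed.

Lemma unmatched_dyck_word (t : bintree) : unmatched (dyck_word t) = (0, 0).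
Proof. by elim: t => //= l IHl r IHr; rewrite unmatched_cat /= IHl IHr. Qed.

(* The trees of the maximal Dyck factors separated by the unmatched down steps;
   junk values if some up step is unmatched. *)
Fixpoint parse_forest (w : seq bool) : seq bintree :=
  match w with
  | [::] => [:: Leaf]
  | false :: w' => Leaf :: parse_forest w'
  | true :: w' =>
    if parse_forest w' is l :: r :: ts then Node l r :: ts else [:: Leaf]
  end.

Definition tree_of_dyck_word (w : seq bool) : bintree := head Leaf (parse_forest w).

Lemma dyck_wordK : cancel dyck_word tree_of_dyck_word.
Proof.
suff parse_cat t w ts : parse_forest w = Leaf :: ts ->
    parse_forest (dyck_word t ++ w) = t :: ts.
  by move=> t; rewrite /tree_of_dyck_word -[dyck_word t]cats0 (parse_cat t [::] [::]).
elim: t w ts => [|l IHl r IHr] w ts //= ew.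
by rewrite -catA (IHl _ (r :: ts)) //= (IHr _ ts).
Qed.

Lemma parse_forestK (w : seq bool) : (unmatched w).2 = 0 ->
  exists t ts, [/\ parse_forest w = t :: ts, size ts = (unmatched w).1 &
    w = dyck_word t ++ flatten [seq false :: dyck_word u | u <- ts]].
Proof.
elim: w => [|c w IH] /=; first by exists Leaf, [::].
case: (unmatched w) IH => a b /= IH; case: c => /= up0.
  have [|t [[|u ts] [-> sts ew]]] := IH; [by lia|by move: sts => /=; lia|].
  exists (Node t u), ts; split=> //=; first by move: sts => /=; lia.
  by rewrite {1}ew /= -catA.
have [|t [ts [-> sts ew]]] := IH; first by lia.
by exists Leaf, (t :: ts); split=> //=; [rewrite sts; lia|rewrite {1}ew].
Qed.

Lemma tree_of_dyck_wordK (w : seq bool) :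
  unmatched w = (0, 0) -> dyck_word (tree_of_dyck_word w) = w.
Proof.
move=> w0; have [|t [[|u ts] [pw]]] := @parse_forestK w; rewrite w0 //= cats0 => _ ->.
by rewrite dyck_wordK.
Qed.

(* The first and the last point of the path strictly inside each pair of matched
   steps, for the path drawn from abscissa s. *)
Fixpoint spans (t : bintree) (s : nat) : seq (nat * nat) :=
  if t is Node l r then
    (s.+1, (s + (tree_size l).*2).+1) ::
      spans l s.+1 ++ spans r (s + (tree_size l).*2).+2
  else [::].

Definition inside (z : nat) (v : nat * nat) : bool := v.1 <= z <= v.2.

Definition separations (t : bintree) (s x y : nat) : nat :=
  \sum_(v <- spans t s) (inside x v && ~~ inside y v).

Lemma spans_bounds (t : bintree) (s : nat) (v : nat * nat) : v \in spans t s ->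
  [/\ s < v.1, v.1 <= v.2 & v.2 < s + (tree_size t).*2].
Proof.
elim: t s => //= l IHl r IHr s; rewrite inE mem_cat => /or3P[/eqP->|/IHl|/IHr] /=.
- by split; lia.
- by case=> *; split; lia.
by case=> *; split; lia.
Qed.

Lemma size_spans (t : bintree) (s : nat) : size (spans t s) = tree_size t.
Proof. by elim: t s => //= l IHl r IHr s; rewrite size_cat IHl IHr. Qed.

Lemma separations_out (t : bintree) (s x y : nat) :
  ~~ (s < x < s + (tree_size t).*2) -> separations t s x y = 0.
Proof.
move=> out; rewrite /separations big1_seq // => v /andP[_ /spans_bounds[]].
by rewrite /inside; lia.
Qed.

Lemma separations_Node (l r : bintree) (s x y : nat)
    (root := (s.+1, (s + (tree_size l).*2).+1)) :
  separations (Node l r) s x y =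
  (inside x root && ~~ inside y root) + separations l s.+1 x y +
  separations r (s + (tree_size l).*2).+2 x y.
Proof. by rewrite /separations /= big_cons big_cat /= addnA. Qed.

Lemma unmatched_factor1 (c : bool) (i j : nat) : i <= j ->
  unmatched (factor [:: c] i j) =
  (~~ c && (i < 1 <= j) : nat, c && (i < 1 <= j) : nat).
Proof. by case: i j => [|i] [|j] //=; case: c. Qed.

(* A matched pair of steps leaves an unmatched step in the factor between x and
   y if and only if exactly one of x and y is strictly inside. *)
Lemma unmatched_factor_dyck_word (t : bintree) (s x y : nat) : x <= y ->
  unmatched (factor (dyck_word t) (x - s) (y - s)) =
  (separations t s x y, separations t s y x).
Proof.
move=> xy; elim: t s => [|l IHl r IHr] s; first by rewrite /separations !big_nil.
have sub1 z k : z - k - 1 = z - k.+1 by lia.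
have subl z : z - s.+1 - (tree_size l).*2 = z - (s + (tree_size l).*2).+1 by lia.
rewrite [dyck_word _]/= -cat1s -[false :: _]cat1s !factor_cat !unmatched_cat.
rewrite size_dyck_word [size [:: _]]/= !(sub1, subl) IHl IHr.
rewrite !unmatched_factor1; [|lia..].
have outl z z' := @separations_out l s.+1 z z'.
have outr z z' := @separations_out r (s + (tree_size l).*2).+2 z z'.
have {outl} := (outl x y, outl y x); have {outr} := (outr x y, outr y x).
rewrite !separations_Node /inside /bicyclic_mul /=.
move: (separations l _ x y) (separations l _ y x).
move: (separations r _ x y) (separations r _ y x) => rx ry lx ly.
move: (tree_size l).*2 (tree_size r).*2 => K K' [rx0 ry0] [lx0 ly0].
congr pair; lia.
Qed.

Section MatchedSteps.

Variable t : bintree.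

Let w := dyck_word t.
Let sep := separations t 0.

Lemma unmatched_factor_sep (x y : nat) :
  x <= y -> unmatched (factor w x y) = (sep x y, sep y x).
Proof. by move=> xy; rewrite -unmatched_factor_dyck_word // !subn0. Qed.

Lemma sep_eq0 (x y : nat) : sep x y = 0 ->
  {in spans t 0, forall v, inside x v ==> inside y v}.
Proof.
move/eqP; rewrite sum_nat_seq_eq0 => /allP sep0 v /sep0.
by rewrite /= eqb0 negb_and negbK implybE.
Qed.

Lemma sum_spans_starting (x y : nat) : x < y -> y <= size w ->
  \sum_(v <- spans t 0) ((v.1 == x.+1) && (v.2 < y)) =
  nth false w x && (0 < (unmatched (factor w x.+1 y)).1).
Proof.
move=> xy yw.
have := unmatched_factor_sep (ltnW xy); rewrite (factor_cons false) //=.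
have := unmatched_factor_sep (leqnSn x).
rewrite (factor_cons false) //; last exact: leq_trans xy yw.
rewrite [factor w x.+1 x.+1]drop_oversize ?size_take_min ?geq_minl //.
rewrite unmatched_seq1 unmatched_factor_sep //= /bicyclic_mul.
case: (nth false w x) => /= -[no_end no_start] [sep_x _].
  have : sep x.+1 y = sep x y + \sum_(v <- spans t 0) ((v.1 == x.+1) && (v.2 < y)).
    rewrite -big_split; apply: eq_big_seq => /= -[lo hi] v_in.
    have := sep_eq0 (esym no_end) v_in.
    by have [] := spans_bounds v_in; rewrite /inside; lia.
  by lia.
rewrite big1_seq //= => -[lo hi] v_in; have := sep_eq0 (esym no_start) v_in.
by have [] := spans_bounds v_in; rewrite /inside /=; lia.
Qed.

Lemma sum_spans_eq (x y : nat) : x < y -> y < size w ->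
  \sum_(v <- spans t 0) ((v.1 == x.+1) && (v.2 == y)) =
  [&& nth false w x, ~~ nth false w y & unmatched (factor w x.+1 y) == (0, 0)].
Proof.
move=> xy yw; have := sum_spans_starting (leqW xy) yw.
rewrite (factor_rcons false) //.
have -> : \sum_(v <- spans t 0) ((v.1 == x.+1) && (v.2 < y.+1)) =
    \sum_(v <- spans t 0) ((v.1 == x.+1) && (v.2 < y)) +
    \sum_(v <- spans t 0) ((v.1 == x.+1) && (v.2 == y)).
  by rewrite -big_split; apply: eq_bigr => v _ /=; lia.
rewrite sum_spans_starting ?(ltnW yw) // -cats1 unmatched_cat unmatched_seq1.
case: (unmatched _) => a b; rewrite xpair_eqE /bicyclic_mul.
by case: (nth false w x); case: (nth false w y) => /=; lia.
Qed.

End MatchedSteps.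

(** * Statistics of the arcs of a tree *)

(* The arcs (position, value) of the 132-avoiding permutation of a tree, drawn
   with positions starting at u and values starting at v: the maximum separates
   a left block of larger values from a right block of smaller values. *)
Fixpoint tree_arcs (t : bintree) (u v : nat) : seq (nat * nat) :=
  if t is Node l r then
    tree_arcs l u (v + tree_size r) ++
      (u + tree_size l, v + tree_size l + tree_size r) ::
      tree_arcs r (u + tree_size l).+1 v
  else [::].

Lemma positions_tree_arcs (t : bintree) (u v : nat) :
  unzip1 (tree_arcs t u v) = iota u (tree_size t).
Proof.
elim: t u v => // l IHl r IHr u v; rewrite [tree_size _]/= -addnS iotaD.
by rewrite -(IHl u (v + tree_size r)) /= -(IHr _ v) /unzip1 map_cat.
Qed.

Lemma values_tree_arcs (t : bintree) (u v : nat) :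
  perm_eq (unzip2 (tree_arcs t u v)) (iota v (tree_size t)).
Proof.
elim: t u v => // l IHl r IHr u v.
rewrite [tree_size _]/= /unzip2 map_cat [map _ (_ :: _)]/=.
have -> : iota v (tree_size l + tree_size r).+1 = iota v (tree_size r) ++
    iota (v + tree_size r) (tree_size l) ++ [:: v + tree_size l + tree_size r].
  by rewrite -addn1 (addnC (tree_size l)) !iotaD -catA addnAC addnA.
by rewrite -cat1s catA perm_catC !perm_cat ?IHl ?IHr.
Qed.

Lemma size_tree_arcs (t : bintree) (u v : nat) : size (tree_arcs t u v) = tree_size t.
Proof. by rewrite -(size_map fst) [map _ _]positions_tree_arcs size_iota. Qed.

Lemma tree_arcs_bounds (t : bintree) (u v : nat) (a : nat * nat) :
  a \in tree_arcs t u v ->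
  (u <= a.1 < u + tree_size t) /\ (v <= a.2 < v + tree_size t).
Proof.
move=> a_in; split; first by rewrite -mem_iota -(positions_tree_arcs t u v) map_f.
by rewrite -mem_iota -(perm_mem (values_tree_arcs t u v)) map_f.
Qed.

Definition cross (a b : nat * nat) : bool :=
  [&& a.1 < b.1, b.1 < a.2 & a.2 < b.2] || [&& a.2 < b.2, b.2 <= a.1 & a.1 < b.1].

Definition crossings (A : seq (nat * nat)) : nat :=
  \sum_(a <- A) \sum_(b <- A) cross a b.

Definition excedances (A : seq (nat * nat)) : nat := \sum_(a <- A) (a.1 < a.2).

Definition fixed_points (A : seq (nat * nat)) : nat := \sum_(a <- A) (a.2 == a.1).

Definition crossings_between (A B : seq (nat * nat)) : nat :=
  \sum_(a <- A) \sum_(b <- B) (cross a b + cross b a).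

Lemma crossings_cat (A B : seq (nat * nat)) :
  crossings (A ++ B) = crossings A + crossings B + crossings_between A B.
Proof.
rewrite /crossings /crossings_between big_cat /=.
under eq_bigr do rewrite big_cat; under [X in _ + X = _]eq_bigr do rewrite big_cat.
under [X in _ = _ + X]eq_bigr do rewrite big_split.
by rewrite !big_split /= [\sum_(b <- B) \sum_(a <- A) _]exchange_big /=; lia.
Qed.

Lemma crossings_between_eq0 (A B : seq (nat * nat)) :
  (forall a b, a \in A -> b \in B -> ~~ cross a b && ~~ cross b a) ->
  crossings_between A B = 0.
Proof.
move=> nc; rewrite /crossings_between big1_seq // => a /andP[_ aA].
rewrite big1_seq // => b /andP[_ bB].
by have /andP[/negbTE-> /negbTE->] := nc a b aA bB.
Qed.

Lemma crossings_root_left (l r : bintree) (u v : nat)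
    (root := (u + tree_size l, v + tree_size l + tree_size r)) :
  crossings_between (tree_arcs l u (v + tree_size r)) [:: root] =
  minn (tree_size l) (v + tree_size r - u.+1) +
  minn (tree_size l) (u - (v + tree_size r)).
Proof.
rewrite /crossings_between.
transitivity (\sum_(a <- tree_arcs l u (v + tree_size r)) (u + tree_size l < a.2) +
    \sum_(a <- tree_arcs l u (v + tree_size r)) (v + tree_size l + tree_size r <= a.1)).
  rewrite -big_split; apply: eq_big_seq => a /tree_arcs_bounds[].
  by rewrite big_seq1 /cross /=; lia.
rewrite -(big_map snd xpredT (fun y => nat_of_bool (u + tree_size l < y))).
rewrite (perm_big _ (values_tree_arcs l u (v + tree_size r))) /= sum_iota_geq.
rewrite -(big_map fst xpredT
  (fun x => nat_of_bool (v + tree_size l + tree_size r <= x))).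
by rewrite [map _ _]positions_tree_arcs sum_iota_geq; lia.
Qed.

Lemma crossings_tree_arcs (l r : bintree) (u v : nat) :
  crossings (tree_arcs (Node l r) u v) =
    crossings (tree_arcs l u (v + tree_size r)) +
    crossings (tree_arcs r (u + tree_size l).+1 v) +
    (minn (tree_size l) (v + tree_size r - u.+1) +
     minn (tree_size l) (u - (v + tree_size r))).
Proof.
rewrite -crossings_root_left [tree_arcs _ _ _]/= -cat1s catA 2!crossings_cat.
rewrite [crossings_between (_ ++ _) _]crossings_between_eq0 => [|a b]; last first.
  rewrite mem_cat inE => /orP[/tree_arcs_bounds[] + +|/eqP->] /tree_arcs_bounds[];
  by rewrite /cross /=; lia.
have -> : crossings [:: (u + tree_size l, v + tree_size l + tree_size r)] = 0.
  by rewrite /crossings !big_seq1 /cross /=; lia.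
by rewrite !addn0 addnAC.
Qed.

Section Middle.

Variable N : nat.

(* An arc from i to j corresponds to a pair of matched steps whose centre is at
   distance j - i to the left of the middle line. *)
Lemma perm_tree_arcs_spans (t : bintree) (u v s : nat) :
  N + u = s + tree_size t + v ->
  perm_eq [seq (N + a.1 - a.2).*2 | a <- tree_arcs t u v]
          [seq x.1 + x.2 | x <- spans t s].
Proof.
elim: t u v s => // l IHl r IHr u v s /= e.
rewrite !map_cat /= -[X in perm_eq (_ ++ X)]cat1s perm_catCA /=.
have -> : (N + (u + tree_size l) - (v + tree_size l + tree_size r)).*2 =
    s.+1 + (s + (tree_size l).*2).+1 by lia.
by rewrite perm_cons perm_cat ?IHl ?IHr //; lia.
Qed.

Lemma exc_tree_arcs (t : bintree) (u v s : nat) : N + u = s + tree_size t + v ->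
  excedances (tree_arcs t u v) = \sum_(x <- spans t s) (x.1 + x.2 < N.*2).
Proof.
move=> e; rewrite /excedances.
rewrite -[RHS](big_map _ xpredT (fun z => nat_of_bool (z < N.*2))).
rewrite -(perm_big _ (perm_tree_arcs_spans e)) big_map.
by apply: eq_big_seq => a /tree_arcs_bounds[]; lia.
Qed.

Lemma fp_tree_arcs (t : bintree) (u v s : nat) : N + u = s + tree_size t + v ->
  fixed_points (tree_arcs t u v) = \sum_(x <- spans t s) (x.1 + x.2 == N.*2).
Proof.
move=> e; rewrite /fixed_points.
rewrite -[RHS](big_map _ xpredT (fun z => nat_of_bool (z == N.*2))).
rewrite -(perm_big _ (perm_tree_arcs_spans e)) big_map.
by apply: eq_big_seq => a /tree_arcs_bounds[]; lia.
Qed.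

Definition asymmetry (x : nat * nat) : nat :=
  \sum_(p < N) (inside (N - p) x (+) inside (N + p) x).

Lemma asymmetryE (lo hi : nat) : 0 < lo -> lo <= hi -> hi < N.*2 ->
  asymmetry (lo, hi) = minn (hi - lo).+1 ((lo + hi - N.*2) + (N.*2 - (lo + hi))).
Proof.
move=> lo0 lohi hiN; have [centre_left|centre_right] := leqP (lo + hi) N.*2.
  transitivity (\sum_(p < N) ((N - hi) + (hi.+1 - N) <= p < N.+1 - lo)).
    by apply: eq_bigr => p _; have := ltn_ord p; rewrite /inside /=; lia.
  by rewrite sum_interval; lia.
transitivity (\sum_(p < N) ((lo - N) + (N.+1 - lo) <= p < hi.+1 - N)).
  by apply: eq_bigr => p _; have := ltn_ord p; rewrite /inside /=; lia.
by rewrite sum_interval; lia.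
Qed.

(* The asymmetry of a span is twice the contribution of its arc to crossings and
   excedances, less (plus) one if the span lies left (right) of the middle line. *)
Lemma crossings_spans (t : bintree) (u v s : nat) :
  N + u = s + tree_size t + v -> s + (tree_size t).*2 <= N.*2 ->
  (crossings (tree_arcs t u v) + excedances (tree_arcs t u v)).*2 +
    \sum_(x <- spans t s) (N < x.1) =
  \sum_(x <- spans t s) asymmetry x + \sum_(x <- spans t s) (x.2 < N).
Proof.
rewrite /excedances; elim: t u v s => [|l IHl r IHr] u v s e sN.
  by rewrite /crossings !big_nil.
rewrite crossings_tree_arcs /= !big_cat !big_cons !big_cat /=; rewrite /= in e sN.
have := IHl u (v + tree_size r) s.+1 ltac:(lia) ltac:(lia).
have := IHr (u + tree_size l).+1 v (s + (tree_size l).*2).+2 ltac:(lia) ltac:(lia).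
by rewrite asymmetryE; lia.
Qed.

(* Each of the first N steps is the start of a pair of matched steps or its end. *)
Lemma spans_balance (t : bintree) (s : nat) :
  \sum_(x <- spans t s) (x.1 <= N) + \sum_(x <- spans t s) (x.2 < N) =
  minn N (s + (tree_size t).*2) - minn N s.
Proof.
elim: t s => [|l IHl r IHr] s; first by rewrite !big_nil /=; lia.
have := IHl s.+1; have := IHr (s + (tree_size l).*2).+2.
by rewrite /= !big_cons !big_cat /=; lia.
Qed.

Lemma crossings_asymmetry (t : bintree) : tree_size t = N ->
  (crossings (tree_arcs t 0 0) + excedances (tree_arcs t 0 0)).*2 =
  \sum_(x <- spans t 0) asymmetry x.
Proof.
move=> tN; have := @crossings_spans t 0 0 0 ltac:(lia) ltac:(lia).
have := spans_balance t 0.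
have : \sum_(x <- spans t 0) (x.1 <= N) + \sum_(x <- spans t 0) (N < x.1) = N.
  rewrite -big_split -tN -[RHS](size_spans t 0) -sum1_size.
  by apply: eq_bigr => x _ /=; lia.
lia.
Qed.

End Middle.

Section OutwardStatistics.

Variables (n : nat) (tr : bintree).
Hypothesis tr_size : tree_size tr = n.

Let w := dyck_word tr.
Let arcs := tree_arcs tr 0 0.
Let middle p := unmatched (factor w (n - p) (n + p)).

Let size_w : size w = n.*2. Proof. by rewrite size_dyck_word tr_size. Qed.

Lemma sum_spans_by_start (Q : rel nat) :
  \sum_(p < n) \sum_(v <- spans tr 0) ((v.1 == n - p) && Q v.2 (n + p)) =
  \sum_(v <- spans tr 0) ((v.1 <= n) && Q v.2 (n.*2 - v.1)).
Proof.
rewrite exchange_big; apply: eq_big_seq => /= -[lo hi] /spans_bounds[/= lo0 lohi _].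
have -> : (lo <= n) && Q hi (n.*2 - lo) =
    (n - lo < n) && ((lo <= n) && Q hi (n.*2 - lo)).
  by case: (leqP lo n) => [lon|_]; rewrite ?andbF // (_ : n - lo < n) //; lia.
rewrite -sum_ord_eq; apply: eq_bigr => p _; have pn := ltn_ord p.
have -> : (lo == n - p) = (p == n - lo :> nat) && (lo <= n) by lia.
rewrite -andbA; case: eqP => //= ->; case: (leqP lo n) => //= lon.
by rewrite (_ : n + (n - lo) = n.*2 - lo) //; lia.
Qed.

Lemma exc_outward :
  \sum_(p < n) (nth false w (n - p.+1) && (0 < (middle p).1)) = excedances arcs.
Proof.
rewrite (@exc_tree_arcs n _ 0 0 0) ?tr_size //.
transitivity (\sum_(p < n) \sum_(v <- spans tr 0) ((v.1 == n - p) && (v.2 < n + p))).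
  apply: eq_bigr => p _; have pn := ltn_ord p.
  have e : n - p = (n - p.+1).+1 by lia.
  by rewrite /middle e -sum_spans_starting ?size_w //; lia.
rewrite (sum_spans_by_start ltn); apply: eq_big_seq => /= -[lo hi] /spans_bounds[].
by rewrite tr_size /=; lia.
Qed.

Lemma fp_outward :
  \sum_(p < n) [&& nth false w (n - p.+1), ~~ nth false w (n + p) &
                   middle p == (0, 0)] = fixed_points arcs.
Proof.
rewrite (@fp_tree_arcs n _ 0 0 0) ?tr_size //.
transitivity (\sum_(p < n) \sum_(v <- spans tr 0) ((v.1 == n - p) && (v.2 == n + p))).
  apply: eq_bigr => p _; have pn := ltn_ord p.
  have e : n - p = (n - p.+1).+1 by lia.
  by rewrite /middle e -sum_spans_eq ?size_w //; lia.
rewrite (sum_spans_by_start eq_op); apply: eq_big_seq => /= -[lo hi] /spans_bounds[].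
by rewrite tr_size /=; lia.
Qed.

Lemma crs_outward :
  \sum_(p < n) (((middle p).1 + (middle p).2)./2 -
                (nth false w (n - p.+1) && (0 < (middle p).1))) = crossings arcs.
Proof.
apply: double_inj; apply: (@addIn (excedances arcs).*2).
rewrite -!doubleD (crossings_asymmetry tr_size) -exc_outward -big_split.
rewrite -mul2n big_distrr exchange_big; apply: eq_bigr => p _.
have even_middle : ~~ odd ((middle p).1 + (middle p).2).
  have pn := ltn_ord p; rewrite odd_unmatched size_drop size_takel ?size_w; lia.
transitivity ((middle p).1 + (middle p).2); first by rewrite /=; lia.
rewrite /middle unmatched_factor_sep; last by lia.
by rewrite /= -big_split; apply: eq_bigr => v _; do 2 case: inside.
Qed.

Lemma outward_weight_dyck_word (R : comNzRingType) (x t q : R) :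
  (outward_weight x t q n w =
   x ^+ fixed_points arcs * t ^+ excedances arcs * q ^+ crossings arcs)%R.
Proof.
by rewrite -fp_outward -exc_outward -crs_outward -!prodrXr -!big_split.
Qed.

End OutwardStatistics.

(** * Permutations avoiding 132 *)

Definition avoids132 (A : seq (nat * nat)) : Prop :=
  forall a b c : nat * nat, a \in A -> b \in A -> c \in A ->
  a.1 < b.1 < c.1 -> ~~ (a.2 < c.2 < b.2).

Lemma tree_arcs_avoids132 (tr : bintree) (u v : nat) : avoids132 (tree_arcs tr u v).
Proof.
elim: tr u v => [|l IHl r IHr] u v a b c // aA bA cA pos; apply/negP => val.
have in_l (x : nat * nat) : x \in tree_arcs (Node l r) u v -> x.1 < u + tree_size l ->
    x \in tree_arcs l u (v + tree_size r).
  by rewrite /= mem_cat inE => /or3P[//|/eqP->|/tree_arcs_bounds[]] /=; lia.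
have in_r (x : nat * nat) : x \in tree_arcs (Node l r) u v ->
    (u + tree_size l < x.1) || (x.2 < v + tree_size r) ->
    x \in tree_arcs r (u + tree_size l).+1 v.
  by rewrite /= mem_cat inE => /or3P[/tree_arcs_bounds[]|/eqP->|//] /=; lia.
have [_ b2] := tree_arcs_bounds bA.
move: (cA); rewrite /= mem_cat inE => /or3P[cl|/eqP ec|cr].
- have [c1 _] := tree_arcs_bounds cl.
  by have /negP[] := IHl _ _ a b c (in_l a aA ltac:(lia)) (in_l b bA ltac:(lia)) cl pos.
- by move: b2 val; rewrite ec /=; lia.
have [_ c2] := tree_arcs_bounds cr.
have ar : a \in tree_arcs r (u + tree_size l).+1 v by apply: in_r => //; lia.
have [a1 _] := tree_arcs_bounds ar.
by have /negP[] := IHr _ _ a b c ar (in_r b bA ltac:(lia)) cr pos.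
Qed.

Lemma avoids132_blocks (A B : seq (nat * nat)) (m : nat * nat) :
  avoids132 (A ++ m :: B) -> {in A, forall a, a.1 < m.1} ->
  {in B, forall b, m.1 < b.1 /\ b.2 < m.2} -> {in A & B, forall a b, b.2 <= a.2}.
Proof.
move=> av Am mB a b aA bB; have [mb bm] := mB b bB; have am := Am a aA.
have := av a m b; rewrite !mem_cat !inE aA bB !eqxx !orbT => /(_ isT isT isT).
by rewrite am mb bm /= andbT -leqNgt; apply.
Qed.

Lemma avoids132_tree_arcs (A : seq (nat * nat)) (u v : nat) :
  unzip1 A = iota u (size A) -> perm_eq (unzip2 A) (iota v (size A)) ->
  avoids132 A -> exists tr, tree_arcs tr u v = A.
Proof.
have [k] := ubnP (size A).
elim: k A u v => // k IH A u v; rewrite ltnS => Ak pos val av.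
case: (posnP (size A)) => [/size0nil->|A0]; first by exists Leaf.
have : v + (size A).-1 \in unzip2 A by rewrite (perm_mem val) mem_iota; lia.
case/mapP=> -[i M] /= iM eM; case/splitPr: iM Ak pos val av A0 eM => A1 A2.
rewrite size_cat [size (_ :: _)]/= addnS [_.+1.-1]/= => Ak pos val av _ eM.
have := pos; rewrite /unzip1 map_cat [map _ (_ :: _)]/= => /iota_cat_cons.
rewrite !size_map => -[pos1 ei pos2].
have {}val : perm_eq (unzip2 A1 ++ unzip2 A2) (iota v (size A1 + size A2)).
  move: val; rewrite /unzip2 map_cat -[(_ + _).+1]addn1 iotaD eM cats1.
  rewrite [map _ (_ :: _)]/= -[M :: map _ _]cat1s perm_catCA.
  by rewrite perm_sym perm_rcons perm_cons perm_sym.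
have blocks : {in unzip2 A1 & unzip2 A2, forall x y, y <= x}.
  move=> _ _ /mapP[a1 aA1 ->] /mapP[b1 bA2 ->].
  apply: (avoids132_blocks av) aA1 bA2 => /= -[j y] jyA.
    by have := map_f fst jyA; rewrite pos1 mem_iota ei /=; lia.
  have := map_f fst jyA; rewrite pos2 mem_iota ei /= => j_pos; split; first lia.
  have : y \in unzip2 A1 ++ unzip2 A2 by rewrite mem_cat (map_f snd jyA) orbT.
  by rewrite (perm_mem val) mem_iota -eM /=; lia.
have [] := perm_iota_split val blocks; rewrite !size_map => val1 val2.
have [||l el] := IH A1 u (v + size A2) _ pos1 val1; first lia.
  by move=> a b c aA bA cA; apply: av; rewrite mem_cat ?aA ?bA ?cA.
have [||r er] := IH A2 (u + size A1).+1 v _ pos2 val2; first lia.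
  by move=> a b c aA bA cA; apply: av; rewrite mem_cat inE ?aA ?bA ?cA !orbT.
have sl : tree_size l = size A1 by rewrite -(size_tree_arcs l u (v + size A2)) el.
have sr : tree_size r = size A2 by rewrite -(size_tree_arcs r (u + size A1).+1 v) er.
by exists (Node l r); rewrite /= sl sr el er ei -eM /= addnA.
Qed.

Definition perm_arcs (n : nat) (s : 'S_n) : seq (nat * nat) :=
  [seq (val i, val (s i)) | i <- enum 'I_n].

Lemma size_perm_arcs (n : nat) (s : 'S_n) : size (perm_arcs s) = n.
Proof. by rewrite size_map size_enum_ord. Qed.

Lemma positions_perm_arcs (n : nat) (s : 'S_n) : unzip1 (perm_arcs s) = iota 0 n.
Proof. by rewrite /unzip1 -map_comp -val_enum_ord; apply: eq_map. Qed.

Lemma values_perm_arcs (n : nat) (s : 'S_n) :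
  perm_eq (unzip2 (perm_arcs s)) (iota 0 n).
Proof.
rewrite /unzip2 -map_comp; apply: uniq_perm; last 1 first.
- move=> k; rewrite mem_iota /= add0n.
  apply/mapP/idP => [[i _ ->]|kn]; first exact: ltn_ord.
  by exists (s^-1%g (Ordinal kn)); rewrite ?mem_enum //= permKV.
- by rewrite map_inj_uniq ?enum_uniq // => i j /= /val_inj/perm_inj.
exact: iota_uniq.
Qed.

Lemma perm_arcs_inj (n : nat) : injective (@perm_arcs n).
Proof.
move=> s s' /eq_in_map e; apply/permP => i; apply: val_inj.
by have := e i; rewrite mem_enum => /(_ isT) [].
Qed.

Lemma big_perm_arcs (n : nat) (s : 'S_n) (F : nat * nat -> nat) :
  \sum_(a <- perm_arcs s) F a = \sum_(i < n) F (val i, val (s i)).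
Proof. by rewrite big_map big_enum. Qed.

Lemma fp_perm_arcs (n : nat) (s : 'S_n) :
  st_fp s = fixed_points (perm_arcs s).
Proof. by rewrite /fixed_points big_perm_arcs /st_fp card_set_sum. Qed.

Lemma exc_perm_arcs (n : nat) (s : 'S_n) :
  st_exc s = excedances (perm_arcs s).
Proof. by rewrite /excedances big_perm_arcs /st_exc card_set_sum. Qed.

Lemma crs_perm_arcs (n : nat) (s : 'S_n) : st_crs s = crossings (perm_arcs s).
Proof.
rewrite /st_crs (card_pair_sum (crossing s)) /crossings big_perm_arcs.
by apply: eq_bigr => i _; rewrite big_perm_arcs.
Qed.

Lemma avoids132_perm_arcs (n : nat) (s : 'S_n) :
  avoids132 (perm_arcs s) <-> ~~ contains p132 s.
Proof.
split=> [av|av _ _ _ /mapP[i _ ->] /mapP[j _ ->] /mapP[k _ ->] /= ijk].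
  apply/contains132P => -[i [j [k [ijk]]]]; apply/negP.
  by apply: (av (val i, val (s i)) (val j, val (s j)) (val k, val (s k)));
    rewrite ?map_f ?mem_enum.
by apply/negP => sijk; apply/(negP av)/contains132P; exists i, j, k.
Qed.

Lemma exists_perm_arcs (A : seq (nat * nat)) (n : nat) :
  unzip1 A = iota 0 n -> perm_eq (unzip2 A) (iota 0 n) ->
  exists s : 'S_n, perm_arcs s = A.
Proof.
move=> pos val_eq; set w := unzip2 A.
have sw : size w = n by rewrite (perm_size val_eq) size_iota.
have lt (i : 'I_n) : nth 0 w i < n.
  have : nth 0 w i \in w by rewrite mem_nth ?sw.
  by rewrite (perm_mem val_eq) mem_iota.
have g_inj : injective (fun i => Ordinal (lt i)).
  move=> i j [/eqP]; rewrite nth_uniq ?sw ?ltn_ord ?(perm_uniq val_eq) ?iota_uniq //.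
  by move/eqP/val_inj.
exists (perm g_inj); rewrite -(zip_unzip (perm_arcs _)) -(zip_unzip A).
rewrite positions_perm_arcs pos -/w; congr zip.
rewrite /unzip2 -map_comp -[RHS](mkseq_nth 0) sw /mkseq -val_enum_ord -map_comp.
by apply: eq_map => i /=; rewrite permE.
Qed.

(* Junk value 1 if tr does not have n nodes. *)
Definition tree_perm (n : nat) (tr : bintree) : 'S_n :=
  odflt 1%g [pick s | perm_arcs s == tree_arcs tr 0 0].

Lemma perm_arcs_tree_perm (n : nat) (tr : bintree) :
  tree_size tr = n -> perm_arcs (tree_perm n tr) = tree_arcs tr 0 0.
Proof.
move=> sz; rewrite /tree_perm; case: pickP => [s /eqP//|none].
have [||s es] := @exists_perm_arcs (tree_arcs tr 0 0) n.
- by rewrite positions_tree_arcs sz.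
- by rewrite -sz values_tree_arcs.
by have := none s; rewrite es eqxx.
Qed.

Lemma tree_arcs_inj (tr tr' : bintree) (u v : nat) :
  tree_size tr = tree_size tr' -> tree_arcs tr u v = tree_arcs tr' u v -> tr = tr'.
Proof.
elim: tr tr' u v => [|l IHl r IHr] [|l' r'] u v // [esz] e.
have findE (k j : bintree) :
    find (fun a : nat * nat => a.2 == v + (tree_size k + tree_size j))
      (tree_arcs (Node k j) u v) = tree_size k.
  rewrite /= find_cat; case: ifP => [/hasP[a /tree_arcs_bounds[_]]|_]; first by lia.
  by rewrite /= addnA eqxx addn0 size_tree_arcs.
have el : tree_size l = tree_size l' by rewrite -(findE l r) esz e findE.
have er : tree_size r = tree_size r' by lia.
move: e => /= /eqP; rewrite -el -er eqseq_cat ?size_tree_arcs // eqseq_cons.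
by case/and3P=> /eqP/(IHl _ _ _ el)-> _ /eqP/(IHr _ _ _ er)->.
Qed.

Section DyckPermutation.

Variable n : nat.

Definition dyck_perm (w : n.*2.-tuple bool) : 'S_n :=
  tree_perm n (tree_of_dyck_word w).

Let dyck_words := [set w : n.*2.-tuple bool | unmatched w == (0, 0)].

Lemma size_tree_of_dyck_word : {in dyck_words, forall w : n.*2.-tuple bool,
  tree_size (tree_of_dyck_word w) = n}.
Proof.
move=> w; rewrite inE => /eqP/tree_of_dyck_wordK e; apply: double_inj.
by rewrite -size_dyck_word e size_tuple.
Qed.

Lemma perm_arcs_dyck_perm : {in dyck_words, forall w : n.*2.-tuple bool,
  perm_arcs (dyck_perm w) = tree_arcs (tree_of_dyck_word w) 0 0}.
Proof. by move=> w /size_tree_of_dyck_word/perm_arcs_tree_perm. Qed.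

Lemma dyck_perm_inj : {in dyck_words &, injective dyck_perm}.
Proof.
move=> w w' wD w'D e; apply: val_inj.
have etr : tree_of_dyck_word w = tree_of_dyck_word w'.
  apply: (@tree_arcs_inj _ _ 0 0); first by rewrite !size_tree_of_dyck_word.
  by rewrite -!perm_arcs_dyck_perm // e.
have dyckK (u : n.*2.-tuple bool) :
    u \in dyck_words -> dyck_word (tree_of_dyck_word u) = u.
  by rewrite inE => /eqP/tree_of_dyck_wordK.
by rewrite /= -(dyckK w) // etr dyckK.
Qed.

Lemma dyck_perm_image : dyck_perm @: dyck_words = avoiders p132 n.
Proof.
apply/setP => s; rewrite inE; apply/imsetP/idP => [[w wD ->]|/avoids132_perm_arcs av].
  apply/avoids132_perm_arcs; rewrite perm_arcs_dyck_perm //.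
  exact: tree_arcs_avoids132.
have [||tr e] := @avoids132_tree_arcs (perm_arcs s) 0 0 _ _ av.
- by rewrite positions_perm_arcs size_perm_arcs.
- by rewrite size_perm_arcs values_perm_arcs.
have sz : tree_size tr = n by rewrite -(size_tree_arcs tr 0 0) e size_perm_arcs.
have sw : size (dyck_word tr) == n.*2 by rewrite size_dyck_word sz.
exists (Tuple sw); first by rewrite inE unmatched_dyck_word.
by apply: perm_arcs_inj; rewrite -e /dyck_perm dyck_wordK perm_arcs_tree_perm.
Qed.

Lemma sum_avoiders132 (R : comNzRingType) (x t q : R) :
  (\sum_(s in avoiders p132 n) x ^+ st_fp s * t ^+ st_exc s * q ^+ st_crs s =
   iter n (motzkin_transfer x t q) (fun h => (h == 0)%:R) 0)%R.
Proof.
pose phi (u : nat * nat) : R := ((u == (0, 0)%N)%:R)%R.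
rewrite -(@sum_outward_weight _ _ _ _ _ phi) => [|h].
  rewrite -dyck_perm_image (big_imset _ dyck_perm_inj) big_mkcond.
  apply: eq_bigr => w _.
  rewrite inE /phi; case: ifP => [wD|_]; last by rewrite mulr0.
  rewrite mulr1 fp_perm_arcs exc_perm_arcs crs_perm_arcs perm_arcs_dyck_perm ?inE //.
  rewrite -(outward_weight_dyck_word (n := n)) ?size_tree_of_dyck_word ?inE //.
  by rewrite tree_of_dyck_wordK //; apply/eqP.
rewrite /antidiagonal_sum /phi; case: h => [|h]; first by rewrite big_ord1.
rewrite big1 // => a _; rewrite xpair_eqE /=.
have -> : (a == 0%N :> nat) && (h.+1.*2 - a == 0)%N = false by have := ltn_ord a; lia.
by [].
Qed.

End DyckPermutation.

Lemma wilf_equiv_132_321 : wilf_equiv [tuple st_fp; st_exc; st_crs] p132 p321.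
Proof.
move=> n; rewrite /gen_poly.
pose X (i : 'I_3) : {mpoly int[3]} := ('X_i)%R.
have monomialE (s : 'S_n) :
    (\prod_(i < 3) 'X_i ^+ tnth [tuple st_fp; st_exc; st_crs] i n s =
     X ord0 ^+ st_fp s * X (lift ord0 ord0) ^+ st_exc s *
     X (lift ord0 (lift ord0 ord0)) ^+ st_crs s)%R.
  by rewrite !big_ord_recl big_ord0 mulr1 mulrA.
rewrite (eq_bigr _ (fun s _ => monomialE s)) [RHS](eq_bigr _ (fun s _ => monomialE s)).
by rewrite sum_avoiders132 sum_avoiders321.
Qed.

Theorem theorem4p2 :
  [/\ forall tau : 'S_3,
        wilf_class [tuple st_fp; st_exc; st_inv; st_crs; st_nes] p132 tau
          <-> tau \in [set p132; p213],
      forall tau : 'S_3,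
        wilf_class [tuple st_fp; st_inv; st_nes] p231 tau
          <-> tau \in [set p231; p312]
    & forall tau : 'S_3,
        wilf_class [tuple st_fp; st_exc; st_crs] p132 tau
          <-> tau \in [set p132; p213; p321]].
Proof.
split=> tau; rewrite /wilf_class; split=> [/wilf_equiv_stat eq_stat|].
- have := fp_eq1_perms3 (etrans (esym (eq_stat ord0)) fp_p132).
  rewrite !inE => /orP[//|/eqP tau321]; case/eqP: inv_p132_neq_p321.
  by rewrite -tau321; exact: (eq_stat (@Ordinal 5 2 isT)).
- rewrite !inE => /orP[] /eqP-> //; apply: wilf_equiv_132_213.
  case=> [[|[|[|[|[|//]]]]] lt]; [exact: fp_rev_compl_inv | exact: exc_rev_compl_inv |
    exact: inv_rev_compl_inv | exact: crs_rev_compl_inv | exact: nes_rev_compl_inv].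
- exact: fp_eq0_perms3 (etrans (esym (eq_stat ord0)) fp_p231).
- rewrite !inE => /orP[] /eqP-> //; apply: wilf_equiv_231_312.
  by case=> [[|[|[|//]]] lt]; [exact: fp_permV | exact: inv_permV | exact: nes_permV].
- exact: fp_eq1_perms3 (etrans (esym (eq_stat ord0)) fp_p132).
rewrite !inE => /orP[/orP[]|] /eqP-> //; last exact: wilf_equiv_132_321.
apply: wilf_equiv_132_213; case=> [[|[|[|//]]] lt];
  [exact: fp_rev_compl_inv | exact: exc_rev_compl_inv | exact: crs_rev_compl_inv].
Qed.
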